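(* The problem of deciding, for a given affine program $G=(N,E,\mathbf{st})$, a given template constraint matrix $T$ (with $m$ rows), and a given program point $v\in N$, whether $V^\sharp[v]>(-\infty,\dots,-\infty)^\top$ holds, is $\Pi^p_2$-hard, where $V^\sharp$ denotes the abstract semantics of $G$ with respect to $T$.
   Context: Write $\overline{\mathbb{R}}=\mathbb{R}\cup\{-\infty,\infty\}$; vectors in $\overline{\mathbb{R}}^m$ are ordered componentwise, and $d>d'$ means $d\ge d'$ and $d\neq d'$. Let $x=(x_1,\dots,x_n)^\top$ be the vector of real program variables. Statements are built from affine assignments $x:=Ax+b$ ($A\in\mathbb{R}^{n\times n}$, $b\in\mathbb{R}^n$) and affine guards $Ax\le b$ ($A\in\mathbb{R}^{k\times n}$, $b\in\mathbb{R}^k$) using sequencing $s_1;s_2$ and nondeterministic choice $s_1\mid s_2$. The collecting semantics $[\![s]\!]:2^{\mathbb{R}^n}\to2^{\mathbb{R}^n}$ is $[\![x:=Ax+b]\!]X=\{Ax+b\mid x\in X\}$, $[\![Ax\le b]\!]X=\{x\in X\mid Ax\le b\}$, $[\![s_1;s_2]\!]=[\![s_2]\!]\circ[\![s_1]\!]$, $[\![s_1\mid s_2]\!]X=[\![s_1]\!]X\cup[\![s_2]\!]X$. An affine program is a triple $G=(N,E,\mathbf{st})$ with $N$ a finite set of program points, $E\subseteq N\times\mathrm{Stmt}\times N$ a finite set of control-flow edges labelled by statements, and $\mathbf{st}\in N$ the start point. A template constraint matrix is $T\in\mathbb{R}^{m\times n}$. Put $\gamma(d)=\{x\in\mathbb{R}^n\mid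 Tx\le d\}$ for $d\in\overline{\mathbb{R}}^m$, $\alpha(X)=\bigwedge\{d\in\overline{\mathbb{R}}^m\mid\gamma(d)\supseteq X\}$ for $X\subseteq\mathbb{R}^n$, and $[\![s]\!]^\sharp=\alpha\circ[\![s]\!]\circ\gamma$. The abstract semantics $V^\sharp:N\to\overline{\mathbb{R}}^m$ of $G$ is the least solution of the constraints $V^\sharp[\mathbf{st}]\ge\alpha(\mathbb{R}^n)$ and $V^\sharp[v]\ge[\![s]\!]^\sharp(V^\sharp[u])$ for all $(u,s,v)\in E$. For the decision problem, all numbers in $G$ and $T$ are rationals encoded in binary; hardness is under polynomial-time many-one reductions; $\Pi^p_2$ is the usual class of the polynomial-time hierarchy. *)

(* Defs.v *)
From Stdlib Require List.
From HB Require Import structures.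
From mathcomp Require Import all_boot all_order all_algebra.
From mathcomp Require Import boolp classical_sets reals ereal.

Set Implicit Arguments.
Unset Strict Implicit.
Unset Printing Implicit Defensive.

Import Order.TTheory GRing.Theory Num.Theory.

Local Open Scope classical_set_scope.
Local Open Scope ring_scope.

Inductive move := MoveL | Stay | MoveR.

(* Tape cells hold a blank ([None]), an input/output bit ([Some (inl b)]) or an
   auxiliary working symbol ([Some (inr e)]). *)
Definition cell (X : finType) : finType := option (bool + X)%type.

Record TM := {
  tm_state : finType;
  tm_aux   : finType;
  tm_tapes : nat; (* number of tapes besides tape 0 *)
  tm_init  : tm_state;
  tm_halt  : pred tm_state;
  tm_delta : tm_state -> {ffun 'I_tm_tapes.+1 -> cell tm_aux} ->
             tm_state * ('I_tm_tapes.+1 -> cell tm_aux * move)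
}.

(* A two-way infinite tape: [tape_left] lists the cells to the left of the head,
   nearest first; [tape_right] lists the scanned cell and those to its right.
   Cells beyond either list are blank. *)
Record tape (X : finType) := Tape {
  tape_left  : seq (cell X);
  tape_right : seq (cell X)
}.

Definition tape_read (X : finType) (t : tape X) : cell X :=
  head None (tape_right t).

Definition tape_write (X : finType) (t : tape X) (a : cell X) : tape X :=
  Tape (tape_left t) (a :: behead (tape_right t)).

Definition tape_move (X : finType) (t : tape X) (d : move) : tape X :=
  let: Tape l r := t in
  match d with
  | MoveL => Tape (behead l) (head None l :: r)
  | Stay  => t
  | MoveR => Tape (head None r :: l) (behead r)
  end.

Definition config (M : TM) : Type :=
  (tm_state M * ('I_(tm_tapes M).+1 -> tape (tm_aux M)))%type.

Definition tm_step (M : TM) (c : config M) : config M :=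
  if tm_halt c.1 then c else
  let qa := tm_delta c.1 [ffun i => tape_read (c.2 i)] in
  (qa.1, fun i => tape_move (tape_write (c.2 i) (qa.2 i).1) (qa.2 i).2).

Definition tm_start (M : TM) (x : seq bool) : config M :=
  (tm_init M,
   fun i => Tape [::] (if i == ord0 then [seq Some (inl b) | b <- x] else [::])).

Fixpoint leading_bits (X : finType) (s : seq (cell X)) : seq bool :=
  if s is Some (inl b) :: s' then b :: leading_bits s' else [::].

(* The output is the word on tape 0 that starts at the head position. *)
Definition tm_output (M : TM) (c : config M) : seq bool :=
  leading_bits (tape_right (c.2 ord0)).

Definition language := set (seq bool).

(* Halting configurations are fixed by [tm_step], so this says that the machine
   halts within [p(|x|)] steps. *)
Definition polytime (f : seq bool -> seq bool) : Prop :=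
  exists (M : TM) (p : {poly nat}), forall x : seq bool,
    let c := iter p.[size x] (@tm_step M) (tm_start M x) in
    tm_halt c.1 /\ tm_output c = f x.

Definition inP (L : language) : Prop :=
  exists2 g : seq bool -> bool,
    polytime (fun x => [:: g x]) & forall x, L x <-> g x.

(* Self-delimiting copy of [w]: every bit is preceded by [true], and [false]
   marks the end. *)
Definition delimit (w : seq bool) : seq bool :=
  flatten [seq [:: true; b] | b <- w] ++ [:: false].

Definition pair_bits (x y : seq bool) : seq bool := delimit x ++ y.

Fixpoint SigmaP (i : nat) (L : language) {struct i} : Prop :=
  match i with
  | 0%N => inP L
  | j.+1 => exists (L' : language) (p : {poly nat}), PiP j L' /\
      forall x, L x <->
        exists y : seq bool, (size y <= p.[size x])%N /\ L' (pair_bits x y)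
  end
with PiP (i : nat) (L : language) {struct i} : Prop :=
  match i with
  | 0%N => inP L
  | j.+1 => exists (L' : language) (p : {poly nat}), SigmaP j L' /\
      forall x, L x <->
        forall y : seq bool, (size y <= p.[size x])%N -> L' (pair_bits x y)
  end.

Definition poly_reduces (L1 L2 : language) : Prop :=
  exists2 f : seq bool -> seq bool, polytime f & forall x, L1 x <-> L2 (f x).

Definition hard (C : language -> Prop) (L : language) : Prop :=
  forall L', C L' -> poly_reduces L' L.

Inductive stmt (F : Type) (n : nat) : Type :=
| Assign of 'M[F]_n & 'cV[F]_n
| Guard (k : nat) of 'M[F]_(k, n) & 'cV[F]_k
| Seq of stmt F n & stmt F n
| Choice of stmt F n & stmt F n.

Arguments Assign {F n} A b.
Arguments Guard {F n k} A b.
Arguments Seq {F n} s1 s2.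
Arguments Choice {F n} s1 s2.

(* The finite edge set is given by a listing of its elements. *)
Record aprog (F : Type) (n : nat) (N : finType) := AProg {
  edges : seq (N * stmt F n * N);
  start : N
}.

Fixpoint map_stmt (F F' : Type) (f : F -> F') (n : nat) (s : stmt F n) :
    stmt F' n :=
  match s with
  | Assign A b => Assign (map_mx f A) (map_mx f b)
  | Guard k A b => Guard (map_mx f A) (map_mx f b)
  | Seq s1 s2 => Seq (map_stmt f s1) (map_stmt f s2)
  | Choice s1 s2 => Choice (map_stmt f s1) (map_stmt f s2)
  end.

Definition map_aprog (F F' : Type) (f : F -> F') (n : nat) (N : finType)
    (G : aprog F n N) : aprog F' n N :=
  AProg [seq (e.1.1, map_stmt f e.1.2, e.2) | e <- edges G] (start G).

Section Semantics.
Variable R : realType.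

Fixpoint collect (n : nat) (s : stmt R n) (X : set 'cV[R]_n) : set 'cV[R]_n :=
  match s with
  | Assign A b => [set A *m x + b | x in X]
  | Guard k A b => [set x | X x /\ forall i, (A *m x) i ord0 <= b i ord0]
  | Seq s1 s2 => collect s2 (collect s1 X)
  | Choice s1 s2 => collect s1 X `|` collect s2 X
  end.

Definition vle (m : nat) (d d' : 'cV[\bar R]_m) : Prop :=
  forall i, (d i ord0 <= d' i ord0)%E.

Definition vlt (m : nat) (d d' : 'cV[\bar R]_m) : Prop :=
  vle d d' /\ d <> d'.

(* Greatest lower bound for the componentwise order [vle]. *)
Definition meet (m : nat) (D : set 'cV[\bar R]_m) : 'cV[\bar R]_m :=
  \col_i ereal_inf [set d i ord0 | d in D].

Definition gamma (m n : nat) (T : 'M[R]_(m, n)) (d : 'cV[\bar R]_m) :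
    set 'cV[R]_n :=
  [set x | forall i, (((T *m x) i ord0)%:E <= d i ord0)%E].

Definition alpha (m n : nat) (T : 'M[R]_(m, n)) (X : set 'cV[R]_n) :
    'cV[\bar R]_m :=
  meet [set d | X `<=` gamma T d].

Definition abs_stmt (m n : nat) (T : 'M[R]_(m, n)) (s : stmt R n)
    (d : 'cV[\bar R]_m) : 'cV[\bar R]_m :=
  alpha T (collect s (gamma T d)).

Section AbstractSemantics.
Variables (n m : nat) (N : finType) (G : aprog R n N) (T : 'M[R]_(m, n)).

Definition abs_solution (V : N -> 'cV[\bar R]_m) : Prop :=
  vle (alpha T setT) (V (start G)) /\
  forall u s v, List.In (u, s, v) (edges G) -> vle (abs_stmt T s (V u)) (V v).

Definition abs_semantics (V : N -> 'cV[\bar R]_m) : Prop :=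
  abs_solution V /\
  forall W, abs_solution W -> forall v, vle (V v) (W v).

End AbstractSemantics.

Lemma vle_trans m (a b c : 'cV[\bar R]_m) : vle a b -> vle b c -> vle a c.
Proof. by move=> ab bc i; exact: le_trans (ab i) (bc i). Qed.

Lemma vle_anti m (a b : 'cV[\bar R]_m) : vle a b -> vle b a -> a = b.
Proof.
by move=> ab ba; apply/colP => i; apply/eqP; rewrite eq_le ab ba.
Qed.

Lemma meet_lb m (D : set 'cV[\bar R]_m) d : D d -> vle (meet D) d.
Proof. by move=> Dd i; rewrite mxE; apply: ereal_inf_lbound; exists d. Qed.

Lemma meet_glb m (D : set 'cV[\bar R]_m) c :
  (forall d, D d -> vle c d) -> vle c (meet D).
Proof.
by move=> cD i; rewrite mxE; apply: le_ereal_inf_tmp => _ [d Dd <-]; exact: cD.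
Qed.

Lemma gamma_mono m n (T : 'M[R]_(m, n)) d d' :
  vle d d' -> gamma T d `<=` gamma T d'.
Proof. by move=> dd' x xd i; exact: le_trans (xd i) (dd' i). Qed.

Lemma alpha_mono m n (T : 'M[R]_(m, n)) X Y :
  X `<=` Y -> vle (alpha T X) (alpha T Y).
Proof.
move=> XY; apply: meet_glb => d Yd; apply: meet_lb.
exact: subset_trans XY Yd.
Qed.

Lemma collect_mono n (s : stmt R n) X Y :
  X `<=` Y -> collect s X `<=` collect s Y.
Proof.
elim: s X Y => [A b|k A b|s1 IH1 s2 IH2|s1 IH1 s2 IH2] X Y XY /=.
- exact: image_subset.
- by move=> x [/XY Yx Axb].
- exact/IH2/IH1.
- by apply: setUSS; [exact: IH1|exact: IH2].
Qed.

Lemma abs_stmt_mono m n (T : 'M[R]_(m, n)) s d d' :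
  vle d d' -> vle (abs_stmt T s d) (abs_stmt T s d').
Proof. by move=> dd'; exact/alpha_mono/collect_mono/gamma_mono. Qed.

Lemma abs_semantics_ex n m (N : finType) (G : aprog R n N) (T : 'M[R]_(m, n)) :
  exists V, abs_semantics G T V.
Proof.
exists (fun v => meet [set V v | V in abs_solution G T]); split; last first.
  by move=> W solW v; apply: meet_lb; exists W.
split=> [|u s v euv]; apply: meet_glb => _ [W solW <-].
  by case: solW.
have [_ /(_ _ _ _ euv)] := solW; apply: vle_trans.
by apply: abs_stmt_mono; apply: meet_lb; exists W.
Qed.

Lemma abs_semantics_uniq n m (N : finType) (G : aprog R n N) (T : 'M[R]_(m, n))
    V W :
  abs_semantics G T V -> abs_semantics G T W -> V = W.
Proof.
move=> [solV leV] [solW leW]; apply/funext => v.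
by apply: vle_anti; [exact: leV|exact: leW].
Qed.

End Semantics.

Record instance := Instance {
  inst_vars   : nat;
  inst_rows   : nat;
  inst_points : nat;
  inst_prog   : aprog rat inst_vars 'I_inst_points;
  inst_templ  : 'M[rat]_(inst_rows, inst_vars);
  inst_target : 'I_inst_points
}.

(* Dimensions, list lengths and program points are written in unary (matrices
   and program points are listed explicitly anyway); numbers in binary. *)
Definition enc_unary (k : nat) : seq bool := rcons (nseq k true) false.

(* Binary digits, least significant first, without leading zeros. *)
Definition binary (k : nat) : seq bool :=
  mkseq (fun i => odd (k %/ 2 ^ i)) (up_log 2 k.+1).

Definition enc_rat (q : rat) : seq bool :=
  (q < 0) :: delimit (binary `|numq q|) ++ delimit (binary `|denq q|).

Definition enc_mx (k l : nat) (A : 'M[rat]_(k, l)) : seq bool :=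
  flatten [seq enc_rat (A i j) | i <- enum 'I_k, j <- enum 'I_l].

Fixpoint enc_stmt (n : nat) (s : stmt rat n) : seq bool :=
  match s with
  | Assign A b => [:: false; false] ++ enc_mx A ++ enc_mx b
  | Guard k A b => [:: false; true] ++ enc_unary k ++ enc_mx A ++ enc_mx b
  | Seq s1 s2 => [:: true; false] ++ enc_stmt s1 ++ enc_stmt s2
  | Choice s1 s2 => [:: true; true] ++ enc_stmt s1 ++ enc_stmt s2
  end.

Definition enc_edge (n p : nat) (e : 'I_p * stmt rat n * 'I_p) : seq bool :=
  enc_unary e.1.1 ++ enc_stmt e.1.2 ++ enc_unary e.2.

Definition enc_aprog (n p : nat) (G : aprog rat n 'I_p) : seq bool :=
  enc_unary (size (edges G)) ++ flatten [seq enc_edge e | e <- edges G] ++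
  enc_unary (start G).

Definition enc_instance (I : instance) : seq bool :=
  enc_unary (inst_vars I) ++ enc_unary (inst_rows I) ++
  enc_unary (inst_points I) ++ enc_aprog (inst_prog I) ++
  enc_mx (inst_templ I) ++ enc_unary (inst_target I).

Definition target_above_bottom (R : realType) (I : instance) : Prop :=
  exists V : 'I_(inst_points I) -> 'cV[\bar R]_(inst_rows I),
    abs_semantics (map_aprog ratr (inst_prog I)) (map_mx ratr (inst_templ I)) V
    /\ vlt (const_mx -oo%E) (V (inst_target I)).

Definition abs_reach_problem (R : realType) : language :=
  [set w | exists I : instance, w = enc_instance I /\ target_above_bottom R I].

Lemma enc_unary_inj k l s t :
  enc_unary k ++ s = enc_unary l ++ t -> k = l /\ s = t.
Proof.
rewrite /enc_unary !cat_rcons; elim: k l => [|k IH] [|l] //= [] //.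
by move=> /IH [-> ->].
Qed.

Lemma delimit_inj v w s t :
  delimit v ++ s = delimit w ++ t -> v = w /\ s = t.
Proof.
rewrite /delimit -!catA; elim: v w => [|b v IH] [|c w] //= [] //.
by move=> -> /IH [-> ->].
Qed.

Lemma binary_inj : injective binary.
Proof.
move=> k l kl; have sz : up_log 2 k.+1 = up_log 2 l.+1.
  by have := congr1 size kl; rewrite !size_mkseq.
have bit i : odd (k %/ 2 ^ i) = odd (l %/ 2 ^ i).
  have [lti|gei] := ltnP i (up_log 2 k.+1).
    have := congr1 (nth false ^~ i) kl.
    by rewrite /binary !nth_mkseq // -sz.
  have small j : (up_log 2 j.+1 <= i -> j %/ 2 ^ i = 0)%N.
    move=> ji; apply: divn_small; rewrite -ltnS.
    rewrite (@leq_ltn_trans (2 ^ i)) //.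
    by apply: leq_trans (leq_pexp2l _ ji) => //; exact: up_logP.
  by rewrite !small // -sz.
clear kl sz; have : forall b, (k < 2 ^ b -> l < 2 ^ b -> k = l)%N.
  move=> b; elim: b k l bit => [|b IH] k l bit.
    by rewrite expn0 !ltnS !leqn0 => /eqP -> /eqP ->.
  move=> kb lb; rewrite -(odd_double_half k) -(odd_double_half l).
  have := bit 0%N; rewrite expn0 !divn1 => ->.
  congr (_ + _.*2)%N; apply: IH => [i||].
  - have := bit i.+1; rewrite expnS.
    by rewrite -!divn2 -!divnMA.
  - by rewrite ltn_half_double -mul2n -expnS.
  - by rewrite ltn_half_double -mul2n -expnS.
move=> /(_ (k + l)%N); apply; apply: (@leq_trans (2 ^ _)%N); try exact: ltn_expl.
- by rewrite leq_exp2l // leq_addr.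
- by rewrite leq_exp2l // leq_addl.
Qed.

Lemma enc_rat_inj q r s t : enc_rat q ++ s = enc_rat r ++ t -> q = r /\ s = t.
Proof.
rewrite /enc_rat !cat_cons => -[sg]; rewrite -catA -[in RHS]catA => /delimit_inj[/binary_inj nq].
move=> /delimit_inj[/binary_inj dq ->]; split=> //.
rewrite -(divq_num_den q) -(divq_num_den r).
have -> : denq q = denq r.
  by rewrite -(gtz0_abs (denq_gt0 q)) -(gtz0_abs (denq_gt0 r)) dq.
suff -> : numq q = numq r by [].
have abs_sg (z : rat) : numq z = (-1) ^+ (z < 0)%R * (`|numq z|%N)%:Z.
  by rewrite -numq_lt0 [LHS]intEsign.
by rewrite (abs_sg q) (abs_sg r) sg nq.
Qed.

Lemma flatten_inj (A : Type) (B : A -> seq bool) (xs ys : seq A) s t :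
  (forall x y s t, B x ++ s = B y ++ t -> x = y /\ s = t) ->
  size xs = size ys ->
  flatten [seq B x | x <- xs] ++ s = flatten [seq B y | y <- ys] ++ t ->
  xs = ys /\ s = t.
Proof.
elim: xs ys => [|x xs IH] [|y ys] //= Binj [sz]; rewrite -!catA.
by move=> /Binj[-> /(IH _ Binj sz)[-> ->]].
Qed.

Lemma enc_mx_inj k l (A B : 'M[rat]_(k, l)) s t :
  enc_mx A ++ s = enc_mx B ++ t -> A = B /\ s = t.
Proof.
rewrite /enc_mx; set I := enum 'I_k; set J := enum 'I_l.
have flat (C : 'M[rat]_(k, l)) :
    [seq enc_rat (C i j) | i <- I, j <- J] =
    [seq enc_rat q | q <- [seq C i j | i <- I, j <- J]].
  by rewrite map_allpairs.
rewrite !flat => /flatten_inj[].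
- exact: enc_rat_inj.
- by rewrite !size_allpairs.
move=> AB ->; split=> //; apply/matrixP => i j.
have /eq_in_allpairs : [seq A i j | i <- I, j <- J] = [seq B i j | i <- I, j <- J].
  exact: AB.
by apply; rewrite mem_enum.
Qed.

Lemma enc_stmt_inj n (s1 s2 : stmt rat n) s t :
  enc_stmt s1 ++ s = enc_stmt s2 ++ t -> s1 = s2 /\ s = t.
Proof.
elim: s1 s2 s t => [A b|k A b|u1 IHu v1 IHv|u1 IHu v1 IHv]
    [A' b'|k' A' b'|u2 v2|u2 v2] s t //= []; rewrite -!catA.
- by move=> /enc_mx_inj[-> /enc_mx_inj[-> ->]].
- move=> /enc_unary_inj[ekk]; move: A' b'; rewrite -ekk => A' b'.
  by move=> /enc_mx_inj[-> /enc_mx_inj[-> ->]].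
- by move=> /IHu[-> /IHv[-> ->]].
- by move=> /IHu[-> /IHv[-> ->]].
Qed.

Lemma enc_edge_inj n p (e f : 'I_p * stmt rat n * 'I_p) s t :
  enc_edge e ++ s = enc_edge f ++ t -> e = f /\ s = t.
Proof.
case: e f => [[u a] v] [[u' a'] v']; rewrite /enc_edge /= -!catA.
by move=> /enc_unary_inj[/val_inj -> /enc_stmt_inj[-> /enc_unary_inj[/val_inj -> ->]]].
Qed.

Lemma enc_aprog_inj n p (G H : aprog rat n 'I_p) s t :
  enc_aprog G ++ s = enc_aprog H ++ t -> G = H /\ s = t.
Proof.
case: G H => [E st] [E' st']; rewrite /enc_aprog /= -!catA.
move=> /enc_unary_inj[sz] /flatten_inj[||-> /enc_unary_inj[/val_inj -> ->]] //.
exact: enc_edge_inj.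
Qed.

Lemma enc_instance_inj : injective enc_instance.
Proof.
case=> [n m p G T v] [n' m' p' G' T' v']; rewrite /enc_instance /=.
move=> /enc_unary_inj[en] /enc_unary_inj[em] /enc_unary_inj[ep].
move: G' T' v'; rewrite -en -em -ep => G' T' v'.
move=> /enc_aprog_inj[-> /enc_mx_inj[->]].
rewrite -[X in X = _]cats0 -[X in _ = X]cats0.
by move=> /enc_unary_inj[/val_inj ->].
Qed.

(* Main.v *)
Require Import Defs.
From HB Require Import structures.
From mathcomp Require Import all_boot all_order all_algebra.
From mathcomp Require Import boolp classical_sets reals ereal.
From mathcomp Require Import zify ring lra.

Set Implicit Arguments.
Unset Strict Implicit.
Unset Printing Implicit Defensive.

(* Let L x hold iff for all y with |y| <= p(|x|) there is z with
   |z| <= q(|(x, y)|) such that a machine M accepts ((x, y), z) in polynomial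
   time. For x, take the affine program that sets a counter c to 0, then runs
   any number of times a statement S, and reaches the target when c >= 1, with
   the template constraining c only. The abstract value at the loop is thus an
   upper bound of c. S writes c in base 3 with p(|x|) digits, which represent a
   word y (the digits 0 and 1 are bits, 2 is skipped), guesses z, simulates M
   and, if M accepts, adds 3^-p(|x|) to c. If S succeeds for every y, the bound
   climbs to 1; otherwise it gets stuck at the first value of c whose word y
   has no witness, because S never starts from a c that is not a multiple of
   3^-p(|x|).

   S simulates M with a number of real variables that does not depend on x:
   each half of a tape is a stack coded by one real, pushed and popped by
   affine maps, and the polynomial length bounds are read off a vector of
   powers, on which n |-> a n + b acts linearly. A step of M is a nondeterministic
   choice between constantly many guarded assignments, so S is a constant
   statement repeated (|x| + 1)^D c times, preceded by one constant assignment
   per bit of x. Its encoding is printed in polynomial time by nested loops over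
   copies of x. *)

(** * Polynomial-time machines from structured programs *)

Section Programs.
Variables (k : nat) (X : finType).

Definition reads := {ffun 'I_k.+1 -> cell X}.
Definition tapes := 'I_k.+1 -> tape X.

Inductive prog :=
| Act of (reads -> 'I_k.+1 -> cell X * move)
| Then of prog & prog
| While of pred reads & prog
| If of pred reads & prog & prog.

Fixpoint point (P : prog) : finType :=
  match P with
  | Act _ => unit
  | Then P1 P2 => (point P1 + point P2)%type
  | While _ P1 => option (point P1)
  | If _ P1 P2 => option (point P1 + point P2)
  end.

Fixpoint entry (P : prog) : point P :=
  match P with
  | Act _ => tt
  | Then P1 _ => inl (entry P1)
  | While _ _ => None
  | If _ _ _ => None
  end.

Definition idle (r : reads) (i : 'I_k.+1) : cell X * move := (r i, Stay).

(** The next point [None] means that the program is done. [While] and [If] spend one idle step on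
    each test, whereas [Then] passes to its second part within the last step of the first. *)
Fixpoint pstep (P : prog) :
    point P -> reads -> option (point P) * ('I_k.+1 -> cell X * move) :=
  match P with
  | Act a => fun _ r => (None, a r)
  | Then P1 P2 => fun s r =>
      match s with
      | inl s1 => let: (o, a) := pstep s1 r in
          (if o is Some s1' then Some (inl s1') else Some (inr (entry P2)), a)
      | inr s2 => let: (o, a) := pstep s2 r in (omap inr o, a)
      end
  | While c P1 => fun s r =>
      match s with
      | None => (if c r then Some (Some (entry P1)) else None, idle r)
      | Some s1 => let: (o, a) := pstep s1 r in (Some o, a)
      end
  | If c P1 P2 => fun s r =>
      match s with
      | None => (Some (Some (if c r then inl (entry P1) else inr (entry P2))),
                 idle r)
      | Some (inl s1) => let: (o, a) := pstep s1 r in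
          (omap (fun u => Some (inl u)) o, a)
      | Some (inr s2) => let: (o, a) := pstep s2 r in
          (omap (fun u => Some (inr u)) o, a)
      end
  end.

Definition scan (t : tapes) : reads := [ffun i => tape_read (t i)].
Definition perform (a : 'I_k.+1 -> cell X * move) (t : tapes) : tapes :=
  fun i => tape_move (tape_write (t i) (a i).1) (a i).2.

Inductive runs (P : prog) : point P -> tapes -> nat -> tapes -> Prop :=
| runs_exit s t a : pstep s (scan t) = (None, a) -> runs s t 1 (perform a t)
| runs_step s s' t a n t' : pstep s (scan t) = (Some s', a) ->
    runs s' (perform a t) n t' -> runs s t n.+1 t'.

Definition prog_tm (P : prog) : TM :=
  {| tm_state := option (point P); tm_aux := X; tm_tapes := k;
     tm_init := Some (entry P); tm_halt := fun s => s == None;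
     tm_delta := fun s r => if s is Some s1 then @pstep P s1 r else (None, idle r) |}.

Lemma runs_tm (P : prog) (s : point P) t n t' : runs s t n t' ->
  iter n (@tm_step (prog_tm P)) (Some s, t) = (None, t').
Proof.
elim=> [{}s {}t a e|{}s s' {}t a {}n {}t' e _ IH].
  by rewrite /= /tm_step /= -/(scan t) e.
by rewrite iterSr {2}/tm_step /= -/(scan t) e.
Qed.

Lemma iter_halted (M : TM) (c : config M) n :
  tm_halt c.1 -> iter n (@tm_step M) c = c.
Proof. by move=> h; elim: n => //= n ->; rewrite /tm_step h. Qed.

(** A Hoare triple for total correctness with a time bound. *)
Definition triple (P : prog) (A B : tapes -> Prop) (n : nat) : Prop :=
  forall t, A t -> exists m t', [/\ m <= n, runs (entry P) t m t' & B t'].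

Lemma runs_thenr (P Q : prog) (s : point Q) t n t' :
  runs s t n t' -> @runs (Then P Q) (inr s) t n t'.
Proof.
elim=> {s t n t'} [s t a e|s s' t a n t' e _ IH].
  by apply: runs_exit; rewrite /= e.
by apply: (@runs_step (Then P Q) _ (inr s') _ _ _ _ _ IH); rewrite /= e.
Qed.

Lemma runs_thenl (P Q : prog) (s : point P) t n t' m t'' :
  runs s t n t' -> runs (entry Q) t' m t'' ->
  @runs (Then P Q) (inl s) t (n + m) t''.
Proof.
move=> H H2; elim: H H2 => {s t n t'} [s t a e|s s' t a n t' e _ IH] H2.
  apply: (@runs_step (Then P Q) _ (inr (entry Q)) _ _ _ _ _ (runs_thenr P H2)).
  by rewrite /= e.
by apply: (@runs_step (Then P Q) _ (inl s') _ _ _ _ _ (IH H2)); rewrite /= e.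
Qed.

Lemma triple_then P Q A B C n m :
  triple P A B n -> triple Q B C m -> triple (Then P Q) A C (n + m).
Proof.
move=> hP hQ t /hP[n1 [t1 [le1 r1 /hQ[n2 [t2 [le2 r2 C2]]]]]].
exists (n1 + n2), t2; split=> //; first exact: leq_add.
by apply: runs_thenl r1 _; apply: r2.
Qed.

Lemma runs_whiler c (P : prog) (s : point P) t n t' m t'' :
  runs s t n t' -> @runs (While c P) None t' m t'' ->
  @runs (While c P) (Some s) t (n + m) t''.
Proof.
move=> H H2; elim: H H2 => {s t n t'} [s t a e|s s' t a n t' e _ IH] H2.
  by apply: (@runs_step (While c P) _ None _ _ _ _ _ H2); rewrite /= e.
by apply: (@runs_step (While c P) _ (Some s') _ _ _ _ _ (IH H2)); rewrite /= e.
Qed.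

Lemma runs_ifl c (P Q : prog) (s : point P) t n t' :
  runs s t n t' -> @runs (If c P Q) (Some (inl s)) t n t'.
Proof.
elim=> {s t n t'} [s t a e|s s' t a n t' e _ IH].
  by apply: runs_exit; rewrite /= e.
by apply: (@runs_step (If c P Q) _ (Some (inl s')) _ _ _ _ _ IH); rewrite /= e.
Qed.

Lemma runs_ifr c (P Q : prog) (s : point Q) t n t' :
  runs s t n t' -> @runs (If c P Q) (Some (inr s)) t n t'.
Proof.
elim=> {s t n t'} [s t a e|s s' t a n t' e _ IH].
  by apply: runs_exit; rewrite /= e.
by apply: (@runs_step (If c P Q) _ (Some (inr s')) _ _ _ _ _ IH); rewrite /= e.
Qed.

(* Idle steps may turn an empty tape representation into an explicit blank. *)
Definition stable (A : tapes -> Prop) : Prop :=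
  forall t, A t -> A (perform (idle (scan t)) t).

Lemma triple_ift (c : pred reads) P Q A B n : stable A -> (forall t, A t -> c (scan t)) ->
  triple P A B n -> triple (If c P Q) A B n.+1.
Proof.
move=> sA cA hP t At; have [m [t' [le r B']]] := hP _ (sA t At).
exists m.+1, t'; split=> //; apply: runs_step; last exact: runs_ifl r.
by rewrite /= cA.
Qed.

Lemma triple_iff (c : pred reads) P Q A B n : stable A -> (forall t, A t -> c (scan t) = false) ->
  triple Q A B n -> triple (If c P Q) A B n.+1.
Proof.
move=> sA cA hQ t At; have [m [t' [le r B']]] := hQ _ (sA t At).
exists m.+1, t'; split=> //; apply: runs_step; last exact: runs_ifr r.
by rewrite /= cA.
Qed.

Lemma triple_act a A B : (forall t, A t -> B (perform (a (scan t)) t)) ->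
  triple (Act a) A B 1.
Proof.
move=> h t At; exists 1, (perform (a (scan t)) t); split=> //; last exact: h.
exact: runs_exit.
Qed.

(** The index of [A] counts the iterations left, so it is invariant and variant at once. Each
    iteration costs its body and one test; the last, failing test costs one step more. *)
Lemma triple_while (c : pred reads) P (A : nat -> tapes -> Prop) n m :
  (forall i, i <= m -> stable (A i)) ->
  (forall i t, i <= m -> A i t -> c (scan t) = (0 < i)) ->
  (forall i, i < m -> triple P (A i.+1) (A i) n) ->
  triple (While c P) (A m) (A 0) (m * n.+1).+1.
Proof.
elim: m => [|m IH] sA cA hP t At.
  exists 1, (perform (idle (scan t)) t); split=> //; last exact: sA.
  by apply: runs_exit; rewrite /= (cA 0).
have [n1 [t1 [le1 r1 A1]]] := hP m (ltnSn m) _ (sA _ (leqnn _) _ At).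
have [||| n2 [t2 [le2 r2 A2]]] := IH _ _ _ _ A1.
- by move=> i im; apply: sA; apply: leqW.
- by move=> i t' im; apply: cA; apply: leqW.
- by move=> i im; apply: hP; apply: leqW.
exists (n1 + n2).+1, t2; split=> //; last first.
  apply: runs_step; first by rewrite /= (cA m.+1).
  exact: runs_whiler r1 r2.
by rewrite mulSn; lia.
Qed.

Lemma triple_weak P (A B A' B' : tapes -> Prop) n n' :
  triple P A B n -> (forall t, A' t -> A t) -> (forall t, B t -> B' t) ->
  n <= n' -> triple P A' B' n'.
Proof.
move=> h hA hB le t /hA/h[m [t' [lem r Bt]]].
by exists m, t'; split=> //; [exact: leq_trans lem le|exact: hB].
Qed.

End Programs.

(** * A machine printing a block polynomially often *)

Section PolyBounded.
Import GRing.Theory.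
Local Open Scope ring_scope.

(** Upper bounds on running times suffice, because halted configurations are fixed by [tm_step]. *)
Definition poly_bounded (T : nat -> nat) : Prop :=
  exists p : {poly nat}, forall n, (T n <= p.[n])%N.

Lemma poly_bounded_const c : poly_bounded (fun=> c).
Proof. by exists c%:P => n; rewrite hornerC. Qed.

Lemma poly_bounded_id : poly_bounded id.
Proof. by exists 'X => n; rewrite hornerX. Qed.

Lemma poly_bounded_add S T : poly_bounded S -> poly_bounded T ->
  poly_bounded (fun n => S n + T n)%N.
Proof.
by move=> [p hp] [q hq]; exists (p + q) => n; rewrite hornerD leq_add.
Qed.

Lemma poly_bounded_mul S T : poly_bounded S -> poly_bounded T ->
  poly_bounded (fun n => S n * T n)%N.
Proof.
by move=> [p hp] [q hq]; exists (p * q) => n; rewrite hornerM leq_mul.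
Qed.

Lemma poly_bounded_succ T : poly_bounded T -> poly_bounded (fun n => (T n).+1).
Proof.
move=> hT; have [p hp] := poly_bounded_add hT (poly_bounded_const 1).
by exists p => n; rewrite -addn1.
Qed.

End PolyBounded.

(** * Tapes up to trailing blanks *)

Section Streams.
Variable X : finType.
Implicit Types (l s : seq (cell X)) (t : tape X).

(* Tapes are compared as infinite streams, since moves may append explicit
   blanks to either list. *)
Definition streq l s : Prop := forall j, nth None l j = nth None s j.

Lemma streq_behead l s : streq l s -> streq (behead l) (behead s).
Proof. by move=> h j; rewrite !nth_behead. Qed.

Lemma streq_head l s : streq l s -> head None l = head None s.
Proof. by move=> /(_ 0); rewrite !nth0. Qed.

Lemma streq_cons a l s : streq l s -> streq (a :: l) (a :: s).
Proof. by move=> h []. Qed.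

Lemma streq_eta l s : streq l s -> streq (head None l :: behead l) s.
Proof. by case: l => // h [|j]; rewrite -h //= nth_nil. Qed.

Lemma streq_leading_bits l (s : seq bool) :
  streq l [seq Some (inl b) | b <- s] -> leading_bits l = s.
Proof.
elim: s l => [|b s IH] [|a l] h //=.
- by have := h 0 => /= ->.
- by have := h 0.
- by have := h 0 => /= ->; rewrite (IH l) // => j; have := h j.+1.
Qed.

Definition at_pos (w : seq (cell X)) (i : nat) (t : tape X) : Prop :=
  streq (tape_left t) (rev (take i w)) /\ streq (tape_right t) (drop i w).

Lemma at_pos_read w i t : at_pos w i t -> tape_read t = nth None w i.
Proof. by case=> _ /streq_head e; rewrite /tape_read e -nth0 nth_drop addn0. Qed.

Lemma at_pos_stay w i t : at_pos w i t ->
  at_pos w i (tape_move (tape_write t (tape_read t)) Stay).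
Proof. by case: t => l r [hl hr]; split=> //=; exact: streq_eta. Qed.

Lemma at_pos_right w i t : i < size w -> at_pos w i t ->
  at_pos w i.+1 (tape_move (tape_write t (tape_read t)) MoveR).
Proof.
move=> lt ap; rewrite (at_pos_read ap); case: t ap => l r [/= hl hr]; split=> /=.
  by rewrite (take_nth None lt) rev_rcons; exact: streq_cons.
by move/streq_behead: hr; rewrite (drop_nth None lt).
Qed.

Lemma at_pos_left w i t : i < size w -> at_pos w i.+1 t ->
  at_pos w i (tape_move (tape_write t (tape_read t)) MoveL).
Proof.
move=> lt ap; case: t ap => l r [/=].
rewrite (take_nth None lt) rev_rcons => hl hr; split=> /=.
  exact: streq_behead hl.
rewrite (drop_nth None lt) (streq_head hl) /=; apply: streq_cons.
exact: streq_eta.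
Qed.

End Streams.

(** * Printing by nested loops over copies of the input *)

Section Emitter.
Variable D : nat.
Local Notation k := D.+1.
Local Notation tapes := (tapes k unit).
Local Notation reads := (reads k unit).
Local Notation prog := (prog k unit).
Implicit Types (x out s : seq bool) (ps : 'I_k.+1 -> nat) (t : tapes).

Definition sentinel : cell unit := Some (inr tt).
Definition bits s : seq (cell unit) := [seq Some (inl b) | b <- s].

(** The head rests on the cell just left of the output, where the next bit will be written; the
    content of that cell is arbitrary. *)
Definition out_tape out (t : tape unit) : Prop :=
  streq (tape_left t) [::] /\ streq (behead (tape_right t)) (bits out).

(* The input is kept, behind a sentinel, on every tape but tape 0, on which the
   output is written from right to left. *)
Definition emit_state x ps out t : Prop :=
  (forall i, i != ord0 -> at_pos (sentinel :: bits x) (ps i) (t i)) /\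
  out_tape out (t ord0).

Definition act1 (i : 'I_k.+1) (f : cell unit -> cell unit * move) : prog :=
  Act (fun r j => if j == i then f (r j) else (r j, Stay)).

(** The output grows to the left, so the last bit of [s] is written first. *)
Fixpoint emit s : prog :=
  if s is b :: s' then Then (emit s') (act1 ord0 (fun=> (Some (inl b), MoveL)))
  else Act (@idle k unit).

Definition setp ps a i : 'I_k.+1 -> nat := fun j => if j == a then i else ps j.

Lemma setp_id ps a : setp ps a (ps a) = ps.
Proof. by apply/funext => j; rewrite /setp; case: eqP => // ->. Qed.

Lemma setpE ps a i : setp ps a i a = i.
Proof. by rewrite /setp eqxx. Qed.

Lemma out_tape_stay out (t : tape unit) : out_tape out t ->
  out_tape out (tape_move (tape_write t (tape_read t)) Stay).
Proof. by case: t. Qed.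

Lemma emit_state_stable x ps out : stable (emit_state x ps out).
Proof.
move=> t [ap o]; split=> [i i0|]; rewrite /perform /idle /= ffunE.
  exact: at_pos_stay (ap _ i0).
exact: out_tape_stay.
Qed.

Lemma triple_emit x ps out s :
  triple (emit s) (emit_state x ps out) (emit_state x ps (s ++ out)) (size s).+1.
Proof.
elim: s => [|b s IH] /=.
  exact/triple_act/emit_state_stable.
rewrite -(addn1 (size s).+1); apply: triple_then IH _.
apply: triple_act => t [ap [l r]]; split=> [i i0|].
  rewrite /perform (negPf i0) ffunE; exact: at_pos_stay (ap _ i0).
rewrite /perform eqxx; case: (t ord0) l r => l r /= hl hr; split=> /=.
  by move/streq_behead: hl.
exact: streq_cons.
Qed.

Lemma triple_right x ps out a i : a != ord0 -> i < (size x).+1 ->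
  triple (act1 a (fun c => (c, MoveR))) (emit_state x (setp ps a i) out)
    (emit_state x (setp ps a i.+1) out) 1.
Proof.
move=> a0 lt; apply: triple_act => t [ap o]; split=> [j j0|].
  have := ap j j0; rewrite /perform /setp ffunE; case: eqP => [->|_].
    by apply: at_pos_right; rewrite /= size_map.
  exact: at_pos_stay.
by rewrite /perform eq_sym (negPf a0) ffunE; exact: out_tape_stay.
Qed.

Lemma triple_left x ps out a i : a != ord0 -> i < (size x).+1 ->
  triple (act1 a (fun c => (c, MoveL))) (emit_state x (setp ps a i.+1) out)
    (emit_state x (setp ps a i) out) 1.
Proof.
move=> a0 lt; apply: triple_act => t [ap o]; split=> [j j0|].
  have := ap j j0; rewrite /perform /setp ffunE; case: eqP => [->|_].
    by apply: at_pos_left; rewrite /= size_map.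
  exact: at_pos_stay.
by rewrite /perform eq_sym (negPf a0) ffunE; exact: out_tape_stay.
Qed.

Definition head_at a (c : cell unit) : pred reads := fun r => r a == c.

Lemma emit_state_read x ps out t a : a != ord0 -> emit_state x ps out t ->
  scan t a = nth None (sentinel :: bits x) (ps a).
Proof. by move=> a0 [ap _]; rewrite ffunE; exact: at_pos_read (ap _ a0). Qed.

Lemma nth_bits x i : i < size x -> nth None (bits x) i = Some (inl (nth false x i)).
Proof. by move=> lt; rewrite (nth_map false). Qed.

Lemma nth_sentinel x i :
  (nth None (sentinel :: bits x) i == sentinel) = (i == 0).
Proof.
case: i => [|i] //=; have [lt|le] := ltnP i (size x).
  by rewrite nth_bits.
by rewrite nth_default ?size_map.
Qed.

Lemma nth_blank x i :
  (nth None (sentinel :: bits x) i == None) = (size x < i).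
Proof.
case: i => [|i] //=; rewrite ltnS; have [lt|le] := ltnP i (size x).
  by rewrite nth_bits.
by rewrite nth_default ?size_map.
Qed.

(** The input copies are on tapes 1 to [D.+1]. There is one more than [D] nested loops use, so that
    [tj 0], which [emit_input] reads, exists even for [D = 0]. *)
Definition tj j : 'I_k.+1 := inord j.+1.

Lemma tj_neq0 j : j <= D -> tj j != ord0.
Proof. by move=> le; rewrite -val_eqE /= inordK // ltnS. Qed.

(** The head of [tj i] goes from the blank behind the input to the sentinel, which gives
    [size x + 1] iterations. It is then taken back to the blank, so that the next iteration of an
    enclosing loop finds it there. *)
Fixpoint loop (B : seq bool) (j : nat) : prog :=
  if j is i.+1 then
    Then (While (predC (head_at (tj i) sentinel))
            (Then (act1 (tj i) (fun c => (c, MoveL))) (loop B i)))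
         (While (predC (head_at (tj i) None)) (act1 (tj i) (fun c => (c, MoveR))))
  else emit B.

Fixpoint loop_time (b j n : nat) : nat :=
  if j is i.+1 then
    ((n.+1 * (1 + loop_time b i n).+1).+1 + (n.+1 * 2).+1)%N
  else b.+1.

Lemma flatten_nseqD (T : Type) a b (B : seq T) :
  flatten (nseq (a + b) B) = flatten (nseq a B) ++ flatten (nseq b B).
Proof. by rewrite nseqD flatten_cat. Qed.

Lemma triple_loop x ps out B j : j <= D.+1 ->
  (forall i, i < j -> ps (tj i) = (size x).+1) ->
  triple (loop B j) (emit_state x ps out)
    (emit_state x ps (flatten (nseq ((size x).+1 ^ j) B) ++ out))
    (loop_time (size B) j (size x)).
Proof.
elim: j ps out => [|j IH] ps out jD psj /=.
  by rewrite cats0; exact: triple_emit.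
set n := size x; set a := tj j; have a0 : a != ord0 by exact: tj_neq0.
set out' := flatten _ ++ out; apply: (triple_then (B := emit_state x (setp ps a 0) out')).
  (* The head position [i] is the number of iterations left; the [n.+1 - i] finished ones have
     printed [n.+1 ^ j] blocks each. *)
  pose A i := emit_state x (setp ps a i)
                (flatten (nseq ((n.+1 - i) * n.+1 ^ j) B) ++ out).
  have <- : A n.+1 = emit_state x ps out.
    by rewrite /A subnn /= -(psj j) // setp_id.
  have <- : A 0 = emit_state x (setp ps a 0) out'.
    by rewrite /A subn0 -expnS.
  apply: triple_while => [i _|i t _ At|i lt].
  - exact: emit_state_stable.
  - by rewrite /= /head_at (emit_state_read a0 At) setpE nth_sentinel lt0n.
  - apply: triple_then; first by apply: triple_left.
    rewrite /A subSS.
    have -> : n.+1 - i = (n - i).+1 by lia.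
    rewrite mulSn flatten_nseqD -catA.
    apply: IH => [|l lj]; first exact: ltnW.
    rewrite /setp; case: eqP => [e|_]; last by apply: psj; exact: leqW.
    by move/(congr1 val): e; rewrite /= !inordK; lia.
have {2}-> : ps = setp ps a n.+1 by rewrite -(psj j) // setp_id.
(* On the way back [i] is the distance to the blank, hence the position [n.+1 - i]. *)
pose A i := emit_state x (setp ps a (n.+1 - i)) out'.
have <- : A n.+1 = emit_state x (setp ps a 0) out' by rewrite /A subnn.
have <- : A 0 = emit_state x (setp ps a n.+1) out' by rewrite /A subn0.
apply: triple_while => [i _|i t le At|i lt].
- exact: emit_state_stable.
- by rewrite /= /head_at (emit_state_read a0 At) setpE nth_blank -/n; lia.
- rewrite /A subSS; have -> : n.+1 - i = (n - i).+1 by lia.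
  by apply: triple_right => //; rewrite ltnS leq_subr.
Qed.

Lemma loop_time_poly b j : poly_bounded (loop_time b j).
Proof.
elim: j => [|j IH] /=; first exact: poly_bounded_const.
have s := poly_bounded_succ poly_bounded_id.
apply: poly_bounded_add; apply: poly_bounded_succ; apply: poly_bounded_mul => //.
  by do ! apply: poly_bounded_succ.
exact: poly_bounded_const.
Qed.

(** The input is read from its last bit to its first, matching the direction of output, so the
    blocks end up in the order of the input. *)
Definition emit_input (X : bool -> seq bool) : prog :=
  While (predC (head_at (tj 0) sentinel))
    (Then (If (head_at (tj 0) (Some (inl true))) (emit (X true)) (emit (X false)))
          (act1 (tj 0) (fun c => (c, MoveL)))).

Lemma triple_emit_input x ps out X : ps (tj 0) = size x ->
  triple (emit_input X) (emit_state x ps out)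
    (emit_state x (setp ps (tj 0) 0) (flatten [seq X b | b <- x] ++ out))
    (size x * (size (X true) + size (X false)).+4).+1.
Proof.
move=> psx; set a := tj 0; have a0 : a != ord0 by exact: tj_neq0.
pose A i := emit_state x (setp ps a i) (flatten [seq X b | b <- drop i x] ++ out).
have <- : A (size x) = emit_state x ps out.
  by rewrite /A drop_size -psx setp_id.
have -> : emit_state x (setp ps a 0) (flatten [seq X b | b <- x] ++ out) = A 0.
  by rewrite /A drop0.
apply: triple_while => [i _|i t _ At|i lt].
- exact: emit_state_stable.
- by rewrite /= /head_at (emit_state_read a0 At) setpE nth_sentinel lt0n.
- rewrite -[(_ + _).+3]addn1.
  apply: triple_then; last by apply: triple_left => //; exact: leqW.
  rewrite (drop_nth false lt) /= -catA.
  have rd t : A i.+1 t -> head_at (tj 0) (Some (inl true)) (scan t) = nth false x i.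
    move=> At; rewrite /head_at (emit_state_read a0 At) setpE /= nth_bits //.
  have tr b := @triple_emit x (setp ps a i.+1) (flatten [seq X b | b <- drop i.+1 x] ++ out) (X b).
  case E: (nth false x i) rd => rd.
    apply: triple_ift rd _; first exact: emit_state_stable.
    by apply: triple_weak (tr true) _ _ _ => //; lia.
  apply: triple_iff rd _; first exact: emit_state_stable.
  by apply: triple_weak (tr false) _ _ _ => //; lia.
Qed.

(** Tape 0 is erased while it is copied, because the output goes there. *)
Definition copy_input : prog :=
  Then (Act (fun r i => if i == ord0 then (r i, Stay) else (sentinel, MoveR)))
       (While (predC (head_at ord0 None))
          (Act (fun r i => (if i == ord0 then None else r ord0, MoveR)))).

Lemma triple_copy_input x :
  triple copy_input (fun t => t = (tm_start (prog_tm copy_input) x).2)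
    (emit_state x (fun=> (size x).+1) [::]) (1 + (size x * 2).+1).
Proof.
(* Here [i] is the number of input bits still to be copied. *)
pose A i t := [/\ streq (tape_left (t ord0)) [::],
  streq (tape_right (t ord0)) (drop (size x - i) (bits x)) &
  forall j, j != ord0 ->
    streq (tape_left (t j)) (rev (take (size x - i).+1 (sentinel :: bits x))) /\
    streq (tape_right (t j)) [::]].
apply: (triple_then (B := A (size x))).
  apply: triple_act => t ->; split; rewrite /perform /= ?subnn ?ffunE /=.
  - by [].
  - by apply: streq_eta; rewrite drop0.
  - by move=> j /negPf j0; rewrite j0 take0.
apply: (triple_weak (A := A (size x)) (B := A 0)) (leqnn _) => //; last first.
  move=> t [l r h]; split=> [i /h[hl hr]|].
    split=> //; first by move: hl; rewrite subn0.
    by rewrite drop_oversize //= size_map.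
  split=> //; move/streq_behead: r; rewrite subn0 drop_oversize //.
  by rewrite size_map.
apply: triple_while => [i _ t [l r h]|i t le [l r h]|i lt].
- split=> //=; first by rewrite /perform /idle /= ffunE; exact: streq_eta.
  by move=> j /h[hl hr]; split=> //=; rewrite /perform /idle ffunE; exact: streq_eta.
- rewrite /= /head_at ffunE /tape_read (streq_head r) -nth0 nth_drop addn0.
  case: i le r {h} => [|i] le r.
    by rewrite subn0 nth_default ?size_map.
  by rewrite nth_bits //; lia.
apply: triple_act => t [l r h].
have e : size x - i = (size x - i.+1).+1 by lia.
have ls : size x - i.+1 < size (bits x) by rewrite size_map; lia.
split=> /=.
- by case=> [|j] //=; rewrite l nth_nil.
- by rewrite e; move/streq_behead: r; rewrite (drop_nth None ls).
- move=> j j0; have /negPf-> := j0; have [hl hr] := h j j0; split=> /=.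
    rewrite e (take_nth None ls) -rcons_cons rev_rcons ffunE.
    rewrite /tape_read (streq_head r) (drop_nth None ls) /=.
    exact: streq_cons.
  by move/streq_behead: hr.
Qed.


(** The pieces are printed from right to left. The move before [emit_input] takes the head of [tj 0]
    off the blank onto the last input bit; the final move puts the head of tape 0 on the first
    output bit. *)
Definition emitter (A C M B : seq bool) (X : bool -> seq bool) : prog :=
  Then copy_input (Then (emit C) (Then (loop B D) (Then (emit M)
    (Then (act1 (tj 0) (fun c => (c, MoveL))) (Then (emit_input X)
      (Then (emit A) (act1 ord0 (fun c => (c, MoveR))))))))).

Lemma polytime_emit (A C M B : seq bool) (X : bool -> seq bool) :
  polytime (fun x => A ++ flatten [seq X b | b <- x] ++ M ++
                     flatten (nseq ((size x).+1 ^ D) B) ++ C).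
Proof.
set f := fun x => _; set P := emitter A C M B X.
pose T n := 1 + (n * 2).+1 + ((size C).+1 + (loop_time (size B) D n +
  ((size M).+1 + (1 + ((n * (size (X true) + size (X false)).+4).+1 +
  ((size A).+1 + 1)))))).
have [p leTp] : poly_bounded T.
  do ! (apply: poly_bounded_add || apply: poly_bounded_mul ||
        apply: poly_bounded_succ || exact: poly_bounded_const ||
        exact: poly_bounded_id || exact: loop_time_poly).
exists (prog_tm P), p => x.
have tl out : triple (act1 (tj 0) (fun c => (c, MoveL)))
    (emit_state x (fun=> (size x).+1) out)
    (emit_state x (setp (fun=> (size x).+1) (tj 0) (size x)) out) 1.
  rewrite -[X in emit_state x X](setp_id _ (tj 0)).
  by apply: triple_left => //; exact: tj_neq0.
have tr : triple P (fun t => t = (tm_start (prog_tm P) x).2)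
    (fun t => streq (tape_right (t ord0)) (bits (f x))) (T (size x)).
  apply: triple_then; first exact: triple_copy_input.
  apply: triple_then; first exact: triple_emit.
  apply: triple_then; first exact: triple_loop.
  apply: triple_then; first exact: triple_emit.
  apply: triple_then.
    exact: tl.
  apply: triple_then; first by apply: triple_emit_input; rewrite setpE.
  apply: triple_then; first exact: triple_emit.
  by apply: triple_act => t [_ [_]]; rewrite /perform /= !cats0.
have [m [t' [le r o]]] := tr _ erefl.
have -> /= : iter p.[size x]%R (@tm_step (prog_tm P)) (tm_start (prog_tm P) x) = (None, t').
  rewrite -(subnK (leq_trans le (leTp _))) iterD /tm_start (runs_tm r).
  exact: iter_halted.
by split=> //; exact: streq_leading_bits.
Qed.

End Emitter.

Import Order.TTheory GRing.Theory Num.Theory.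
Local Open Scope ring_scope.

(** * Affine statements over named variables *)

Section Affine.
Variables (R : realType) (V : finType).
Local Notation env := (V -> R).
Implicit Types (x y : env).

Definition aexp : Type := ((V -> rat) * rat)%type.

Definition aval (e : aexp) x : R := \sum_v ratr (e.1 v) * x v + ratr e.2.

Definition acst (c : rat) : aexp := (fun=> 0, c).
Definition avar (v : V) : aexp := (fun w => (w == v)%:R, 0).
Definition aadd (e f : aexp) : aexp := (fun v => e.1 v + f.1 v, e.2 + f.2).
Definition ascale (c : rat) (e : aexp) : aexp := (fun v => c * e.1 v, c * e.2).
Definition asum (I : finType) (F : I -> aexp) : aexp :=
  (fun v => \sum_i (F i).1 v, \sum_i (F i).2).

Lemma aval_cst c x : aval (acst c) x = ratr c.
Proof. by rewrite /aval big1 ?add0r // => v _; rewrite rmorph0 mul0r. Qed.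

Lemma aval_var v x : aval (avar v) x = x v.
Proof.
rewrite /aval rmorph0 addr0 (bigD1 v) //= eqxx rmorph1 mul1r big1 ?addr0 // => w.
by move=> /negPf->; rewrite rmorph0 mul0r.
Qed.

Lemma aval_add e f x : aval (aadd e f) x = aval e x + aval f x.
Proof.
rewrite /aval /= rmorphD addrACA -big_split; congr (_ + _).
by apply: eq_bigr => v _; rewrite rmorphD mulrDl.
Qed.

Lemma aval_scale c e x : aval (ascale c e) x = ratr c * aval e x.
Proof.
rewrite /aval /= rmorphM mulrDr mulr_sumr; congr (_ + _).
by apply: eq_bigr => v _; rewrite rmorphM mulrA.
Qed.

Lemma aval_sum (I : finType) (F : I -> aexp) x :
  aval (asum F) x = \sum_i aval (F i) x.
Proof.
rewrite /aval /= big_split /= exchange_big rmorph_sum; congr (_ + _).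
by apply: eq_bigr => v _; rewrite rmorph_sum mulr_suml.
Qed.

Definition avalE := (aval_cst, aval_var, aval_add, aval_scale, aval_sum).

Definition vec x : 'cV[R]_#|V| := \col_i x (enum_val i).
Definition unvec (y : 'cV[R]_#|V|) : env := fun v => y (enum_rank v) ord0.

Lemma vecK : cancel vec unvec.
Proof. by move=> x; apply/funext => v; rewrite /unvec mxE enum_rankK. Qed.

Lemma unvecK : cancel unvec vec.
Proof. by move=> y; apply/colP => i; rewrite mxE /unvec enum_valK. Qed.

Lemma coef_aval (e : aexp) x :
  \sum_(j < #|V|) ratr (e.1 (enum_val j)) * x (enum_val j) + ratr e.2 = aval e x.
Proof.
rewrite /aval (reindex (@enum_val V V)) //=.
by exists enum_rank => v _; [rewrite enum_valK|rewrite enum_rankK].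
Qed.

Definition assign (u : V -> aexp) : stmt rat #|V| :=
  Assign (\matrix_(i, j) (u (enum_val i)).1 (enum_val j))
         (\col_i (u (enum_val i)).2).

(** A list of affine expressions stands for the constraints that each of them is at most 0; hence
    the minus sign on the right-hand side. *)
Definition guard (g : seq aexp) : stmt rat #|V| :=
  @Guard rat _ (size g) (\matrix_(i, j) (tnth (in_tuple g) i).1 (enum_val j))
         (\col_i - (tnth (in_tuple g) i).2).

Definition run (s : stmt rat #|V|) x y : Prop :=
  collect (map_stmt ratr s) [set vec x] (vec y).

(** The collecting semantics commutes with unions, so it is determined by its values on singletons.
    This allows statements to be treated as relations [run] between states. *)
Lemma collect_single n (s : stmt R n) (X : set 'cV[R]_n) z :
  collect s X z <-> exists2 x, X x & collect s [set x] z.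
Proof.
elim: s X z => [A b|k A b|s1 IH1 s2 IH2|s1 IH1 s2 IH2] X z /=.
- split=> [[x Xx <-]|[x Xx [_ -> <-]]]; last by exists x.
  by exists x => //; exists x.
- split=> [[Xz h]|[x Xx [-> h]]] //; by exists z.
- split=> [/IH2[y /IH1[x Xx xy] yz]|[x Xx /IH2[y xy yz]]].
    by exists x => //; apply/IH2; exists y.
  by apply/IH2; exists y => //; apply/IH1; exists x.
- split=> [[/IH1|/IH2] [x Xx xz]|[x Xx [xz|xz]]].
  + by exists x => //; left.
  + by exists x => //; right.
  + by left; apply/IH1; exists x.
  + by right; apply/IH2; exists x.
Qed.

Lemma collect_run s (X : set 'cV[R]_#|V|) (y : 'cV[R]_#|V|) :
  collect (map_stmt ratr s) X y <-> exists2 x, X (vec x) & run s x (unvec y).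
Proof.
rewrite collect_single; split=> [[x Xx xy]|[x Xx xy]].
  by exists (unvec x); rewrite /run !unvecK.
by exists (vec x) => //; move: xy; rewrite /run unvecK.
Qed.

Lemma vec_inj : injective vec. Proof. exact: can_inj vecK. Qed.

Lemma run_assign u x y : run (assign u) x y <-> y = fun v => aval (u v) x.
Proof.
rewrite /run /=.
have e : map_mx ratr (\matrix_(i, j) (u (enum_val i)).1 (enum_val j)) *m vec x
   + map_mx ratr (\col_i (u (enum_val i)).2) = vec (fun v => aval (u v) x) :> 'cV[R]_#|V|.
  apply/colP => i; rewrite !mxE -coef_aval; congr (_ + _).
  by apply: eq_bigr => j _; rewrite !mxE.
split=> [[_ -> ]|->]; last by exists (vec x).
by rewrite e => /vec_inj.
Qed.

Lemma run_guard g x y :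
  run (guard g) x y <-> y = x /\ all (fun e => aval e x <= 0) g.
Proof.
rewrite /run /=; split=> [[/vec_inj -> h]|[-> h]]; split=> //.
  apply/allP => e /(nthP e)[i lt <-]; have := h (Ordinal lt).
  rewrite !mxE -[nth e g i]/(nth e (in_tuple g) (Ordinal lt)) -tnth_nth.
  rewrite -coef_aval rmorphN -subr_le0 opprK; congr (_ + _ <= _).
  by apply: eq_bigr => j _; rewrite !mxE.
move=> i; rewrite !mxE rmorphN -subr_le0 opprK.
have -> : \sum_j map_mx ratr (\matrix_(i, j) (tnth (in_tuple g) i).1 (enum_val j)) i j
   * vec x j ord0 = \sum_(j < #|V|) ratr ((tnth (in_tuple g) i).1 (enum_val j)) * x (enum_val j) :> R.
  by apply: eq_bigr => j _; rewrite !mxE.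
by rewrite coef_aval; apply: (allP h); exact: mem_tnth.
Qed.

Lemma run_seq s t x z : run (Seq s t) x z <-> exists2 y, run s x y & run t y z.
Proof.
rewrite {1}/run /= collect_run vecK; split=> -[y]; first by exists y.
by exists y.
Qed.

Lemma run_choice s t x y : run (Defs.Choice s t) x y <-> run s x y \/ run t x y.
Proof. by []. Qed.

Definition cmd : Type := (seq aexp * (V -> aexp))%type.
Definition cmd_stmt (c : cmd) := Seq (guard c.1) (assign c.2).

Lemma run_cmd c x y : run (cmd_stmt c) x y <->
  all (fun e => aval e x <= 0) c.1 /\ y = fun v => aval (c.2 v) x.
Proof.
rewrite run_seq; split=> [[_ /run_guard[-> h] /run_assign ->]|[h ->]] //.
by exists x; [exact/run_guard|exact/run_assign].
Qed.

Definition choices (c : cmd) (cs : seq cmd) : stmt rat #|V| :=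
  foldr (fun d s => Defs.Choice (cmd_stmt d) s) (cmd_stmt c) cs.

Lemma run_choices (I : eqType) (F : I -> cmd) i0 (s : seq I) x y :
  run (choices (F i0) (map F s)) x y <->
  exists2 i, i \in i0 :: s & run (cmd_stmt (F i)) x y.
Proof.
elim: s => [|i s IH] /=.
  by split=> [h|[i]]; [exists i0; rewrite ?mem_head|rewrite inE => /eqP ->].
rewrite run_choice IH; split=> [[h|[j js h]]|[j]].
- by exists i => //; rewrite !inE eqxx orbT.
- by exists j => //; move: js; rewrite !inE => /orP[->//|->]; rewrite !orbT.
- rewrite !inE => /or3P[/eqP->|/eqP->|js] h.
  + by right; exists i0; rewrite ?mem_head.
  + by left.
  + by right; exists j => //; rewrite inE js orbT.
Qed.

End Affine.

(** * Simulating a machine by guarded affine commands *)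

Section Stacks.
Variable X : finType.

Definition digit (a : cell X) : nat := if a is Some y then (enum_rank y).+1 else 0.
Definition base : nat := (#|{: bool + X}|.+1).*2.

Lemma digit_inj : injective digit.
Proof. by move=> [a|] [b|] //= [/val_inj/enum_rank_inj ->]. Qed.

Lemma digit_lt a : ((digit a).+1.*2 <= base)%N.
Proof. by rewrite /base leq_double ltnS; case: a => //= y; exact: ltn_ord. Qed.

Section Field.
Variable F : realFieldType.

(* The factor 2 in [base] leaves a gap: the value of a stack is at most 1/2, so
   the top digit can be recognized with non-strict inequalities. Blanks have
   digit 0, hence an exhausted list reads as an infinite supply of blanks. *)
Definition stack (s : seq (cell X)) : F :=
  foldr (fun a r => ((digit a)%:R + r) / base%:R) 0 s.

Lemma base_neq0 : base%:R != 0 :> F. Proof. by rewrite pnatr_eq0. Qed.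

Lemma stack_eta s :
  stack s = ((digit (head None s))%:R + stack (behead s)) / base%:R.
Proof. by case: s => //=; rewrite addr0 mul0r. Qed.

Lemma stack_pop s :
  stack (behead s) = base%:R * stack s - (digit (head None s))%:R.
Proof. by rewrite (stack_eta s) mulrC divfK ?base_neq0 // addrAC subrr add0r. Qed.

Lemma stack_cat s1 s2 :
  stack (s1 ++ s2) = stack s1 + base%:R ^- size s1 * stack s2.
Proof.
elim: s1 => [|a s IH] /=; first by rewrite expr0 invr1 mul1r add0r.
by rewrite IH addrA mulrDl exprS invfM mulrAC [base%:R^-1 * _]mulrC -mulrA.
Qed.

(** Below the top digit there is at most 1/2 by induction, and [digit a + 1] is at most half the
    base, so the quotient is again at most 1/2. *)
Lemma stack_bound s : 0 <= stack s <= 2^-1.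
Proof.
elim: s => [|a s /andP[lo hi]] /=; first by rewrite lexx invr_ge0 ler0n.
have := digit_lt a; rewrite -(ler_nat F) -mul2n natrM -[(digit a).+1%:R]natr1 => h.
have d0 : 0 <= (digit a)%:R :> F by rewrite ler0n.
apply/andP; split; first by apply: divr_ge0; [exact: addr_ge0|exact: ler0n].
by rewrite ler_pdivrMr ?ltr0n //; lra.
Qed.

End Field.

Lemma ratr_stack (F : realFieldType) s : ratr (stack rat s) = stack F s.
Proof.
elim: s => [|a s IH] /=; first exact: rmorph0.
by rewrite fmorph_div rmorphD /= !ratr_nat IH.
Qed.

End Stacks.

(** [VC] is the counter. [VDl] is the unit of the last guessed digit and [VVa] the value of the
    guessed digits; [VBu] is the number of guesses left in the phase and [VSt] the control state.
    [VQu] codes the word that will be the input of the machine, and [VWt] is the weight of its next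
    letter. [VL] and [VR] are the tape halves, [VP] the powers of a length. *)
Variant var (k d : nat) :=
  VC | VDl | VVa | VBu | VSt | VWt | VQu | VL of 'I_k | VR of 'I_k | VP of 'I_d.
Arguments VC {k d}. Arguments VDl {k d}. Arguments VVa {k d}. Arguments VBu {k d}.
Arguments VSt {k d}. Arguments VWt {k d}. Arguments VQu {k d}.
Arguments VL {k d}. Arguments VR {k d}. Arguments VP {k d}.

Definition var_code k d (v : var k d) : (bool * bool * bool) + 'I_k + 'I_k + 'I_d :=
  match v with
  | VC => inl (inl (inl (false, false, false)))
  | VDl => inl (inl (inl (false, false, true)))
  | VVa => inl (inl (inl (false, true, false)))
  | VBu => inl (inl (inl (false, true, true)))
  | VSt => inl (inl (inl (true, false, false)))
  | VWt => inl (inl (inl (true, false, true)))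
  | VQu => inl (inl (inl (true, true, false)))
  | VL i => inl (inl (inr i)) | VR i => inl (inr i) | VP i => inr i
  end.

Definition var_decode k d (c : (bool * bool * bool) + 'I_k + 'I_k + 'I_d) : var k d :=
  match c with
  | inl (inl (inl (false, false, false))) => VC
  | inl (inl (inl (false, false, true))) => VDl
  | inl (inl (inl (false, true, false))) => VVa
  | inl (inl (inl (false, true, true))) => VBu
  | inl (inl (inl (true, false, false))) => VSt
  | inl (inl (inl (true, false, true))) => VWt
  | inl (inl (inl (true, true, _))) => VQu
  | inl (inl (inr i)) => VL i | inl (inr i) => VR i | inr i => VP i
  end.

Lemma var_codeK k d : cancel (@var_code k d) (@var_decode k d).
Proof. by case. Qed.

HB.instance Definition _ k d := Finite.copy (var k d) (can_type (@var_codeK k d)).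

Section Simulation.
Variables (R : realType) (M : TM) (p q : {poly nat}).
Local Notation k := (tm_tapes M).+1.
Local Notation X := (tm_aux M).
Local Notation d := (maxn (size p) (size q)).
Local Notation var := (var k d).
Local Notation aexp := (aexp var).
Local Notation B := (base X).
Local Notation env := (var -> R).
Implicit Types (x y : env) (e f : aexp).

Definition asub e f := aadd e (ascale (-1) f).
Definition aeq e f : seq aexp := [:: asub e f; asub f e].

Lemma aval_sub e f x : aval (asub e f) x = aval e x - aval f x.
Proof. by rewrite !avalE rmorphN1 mulN1r. Qed.

Lemma all_aeq e f x :
  all (fun g => aval g x <= 0) (aeq e f) = (aval e x == aval f x).
Proof. by rewrite /= !aval_sub !subr_le0 andbT eq_le. Qed.

Definition top_is (v : var) (a : cell X) : seq aexp :=
  [:: asub (acst _ (digit a)%:R) (ascale B%:R (avar v));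
      asub (ascale B%:R (avar v)) (acst _ ((digit a)%:R + 2^-1))].

Lemma ratr_half (n : nat) : ratr (n%:R + 2^-1) = n%:R + 2^-1 :> R.
Proof. by rewrite rmorphD fmorphV /= !ratr_nat. Qed.

(** The base times the value is the top digit plus a remainder between 0 and 1/2. It lies in the
    interval tested for [a] only if the two digits differ by less than 1, that is, not at all. *)
Lemma all_top_is v a x s : x v = stack R s ->
  all (fun g => aval g x <= 0) (top_is v a) = (head None s == a).
Proof.
move=> xv; rewrite /= !aval_sub !avalE xv ratr_half !ratr_nat.
have := stack_pop R s; have /andP[] := stack_bound R (behead s).
move: (stack R s) (stack R (behead s)) => u w w0 w2 e.
have {e} -> : B%:R * u = (digit (head None s))%:R + w :> R by rewrite e addrC subrK.
rewrite andbT !subr_le0 -(inj_eq (@digit_inj _)).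
move: (digit _) (digit _) => m n. apply/andP/eqP => [[h1 h2]|->]; last by split; lra.
have : (m%:R < n%:R + 1 :> R) by lra.
have : (n%:R < m%:R + 1 :> R) by lra.
rewrite !natr1 !ltr_nat; lia.
Qed.

(** The binomial expansion of the power [i] of [a n + b], linear in the powers of [n]. *)
Definition pow_upd (a b : nat) (i : 'I_d) : aexp :=
  asum (fun j : 'I_d => ascale ('C(i, j) * a ^ j * b ^ (i - j))%:R (avar (VP j))).

Lemma aval_pow_upd a b i x (N : nat) : (forall j, x (VP j) = N%:R ^+ j) ->
  aval (pow_upd a b i) x = (a * N + b)%:R ^+ i.
Proof.
move=> xP; rewrite avalE addnC -natrX expnDn natr_sum.
(* The sum may run over all [d] stored powers, since the binomial coefficient vanishes for
   [j > i]. *)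
rewrite (big_ord_widen d (fun j => ('C(i, j) * (b ^ (i - j) * (a * N) ^ j))%:R)) //.
rewrite [RHS]big_mkcond; apply: eq_bigr => j _; rewrite !avalE xP ratr_nat ltnS.
case: leqP => [_|lt]; last by rewrite bin_small // mul0n mul0r.
by rewrite expnMn -natrX -natrM; congr _%:R; lia.
Qed.

Definition pol_eval (f : {poly nat}) : aexp :=
  asum (fun j : 'I_d => ascale (nth 0%N f j)%:R (avar (VP j))).

Lemma aval_pol_eval (f : {poly nat}) x (N : nat) : (size f <= d)%N ->
  (forall j, x (VP j) = N%:R ^+ j) -> aval (pol_eval f) x = f.[N]%:R.
Proof.
move=> sf xP; rewrite avalE (horner_coef_wide _ sf) natr_sum.
by apply: eq_bigr => j _; rewrite !avalE xP ratr_nat natrM natrX.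
Qed.

Definition cells (s : seq bool) : seq (cell X) := [seq Some (inl b) | b <- s].

(** The word grows at its far end, unlike the tape stacks, so the new letters must be scaled by the
    weight of the first free place. *)
Definition append_que (s : seq bool) : aexp :=
  aadd (avar VQu) (ascale (stack rat (cells s)) (avar VWt)).
Definition append_wt (s : seq bool) : aexp := ascale (B%:R ^- size s) (avar VWt).

Definition control : finType := (bool + option (tm_state M))%type.
Definition CDigits : control := inl true.
Definition CWitness : control := inl false.
Definition CSim (s : tm_state M) : control := inr (Some s).
Definition CAccept : control := inr None.

(* [dgs] are the digits of the counter and [wrd] the part of the input of [M]
   guessed so far; [bud] bounds the number of further guesses of the phase, and
   [len] is the length whose powers are stored in the variables [VP j]. *)
Record rst := Rst {
  ctl : control;
  dgs : seq (option bool);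
  bud : nat;
  len : nat;
  wrd : seq bool;
  tps : 'I_k -> tape X
}.

Definition dig (a : option bool) : nat := if a is Some b then b else 2.
Definition nval (t : seq (option bool)) : nat :=
  foldl (fun v a => 3 * v + dig a)%N 0%N t.

(** The counter is kept apart from the discrete state, because it may be any real number when the
    loop body starts. *)
Definition encode (c : R) (r : rst) : env := fun v =>
  match v with
  | VC => c
  | VDl => 3%:R ^- size (dgs r)
  | VVa => (nval (dgs r))%:R / 3%:R ^+ size (dgs r)
  | VBu => (bud r)%:R
  | VSt => (enum_rank (ctl r))%:R
  | VWt => B%:R ^- size (wrd r)
  | VQu => stack R (cells (wrd r))
  | VL i => stack R (tape_left (tps r i))
  | VR i => stack R (tape_right (tps r i))
  | VP j => (len r)%:R ^+ j
  end.

Definition ctl_is (c : control) : seq aexp := aeq (avar VSt) (acst _ (enum_rank c)%:R).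

Lemma all_ctl_is c0 r c :
  all (fun g => aval g (encode c0 r) <= 0) (ctl_is c) = (ctl r == c).
Proof.
rewrite all_aeq !avalE /= ratr_nat eqr_nat.
by rewrite (inj_eq val_inj) (inj_eq enum_rank_inj).
Qed.

(** [Skip] pads runs to a prescribed length. [Step] carries the scanned cells and also the cells
    left of the heads, because a move to the left pops the left stack and has to subtract its top
    digit. *)
Variant icmd :=
  Skip | Digit of option bool | EndDigits | Witness of bool | Start
| Step of tm_state M & {ffun 'I_k -> cell X} & {ffun 'I_k -> cell X}
| Accept of tm_state M.

Definition icmd_code (i : icmd) :=
  match i return option bool + option bool +
    (tm_state M * {ffun 'I_k -> cell X} * {ffun 'I_k -> cell X}) + tm_state M + bool with
  | Skip => inl (inl (inl (inl None)))
  | EndDigits => inl (inl (inl (inl (Some true))))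
  | Start => inl (inl (inl (inl (Some false))))
  | Digit a => inl (inl (inl (inr a)))
  | Step s a b => inl (inl (inr (s, a, b)))
  | Accept s => inl (inr s)
  | Witness b => inr b
  end.

Definition icmd_decode c : icmd :=
  match c with
  | inl (inl (inl (inl None))) => Skip
  | inl (inl (inl (inl (Some true)))) => EndDigits
  | inl (inl (inl (inl (Some false)))) => Start
  | inl (inl (inl (inr a))) => Digit a
  | inl (inl (inr (s, a, b))) => Step s a b
  | inl (inr s) => Accept s
  | inr b => Witness b
  end.

Lemma icmd_codeK : cancel icmd_code icmd_decode.
Proof. by case. Qed.

HB.instance Definition _ := Finite.copy icmd (can_type icmd_codeK).

(** A guessed bit belongs to the first component of the outer pair, where [delimit] puts [true]
    before every bit. *)
Definition digit_bits (a : option bool) : seq bool :=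
  if a is Some b then [:: true; b] else [::].

Definition push_exp (a : cell X) e : aexp :=
  ascale B%:R^-1 (aadd (acst _ (digit a)%:R) e).

Definition move_left_exp (i : 'I_k) (b : cell X) (am : cell X * move) : aexp :=
  match am.2 with
  | MoveL => asub (ascale B%:R (avar (VL i))) (acst _ (digit b)%:R)
  | Stay => avar (VL i)
  | MoveR => push_exp am.1 (avar (VL i))
  end.

Definition rest_exp (i : 'I_k) (a : cell X) : aexp :=
  asub (ascale B%:R (avar (VR i))) (acst _ (digit a)%:R).

Definition move_right_exp (i : 'I_k) (a b : cell X) (am : cell X * move) : aexp :=
  match am.2 with
  | MoveL => push_exp b (push_exp am.1 (rest_exp i a))
  | Stay => push_exp am.1 (rest_exp i a)
  | MoveR => rest_exp i a
  end.

(** As a constraint it reads [1 <= 0]; it disables the commands that do not fit the halting status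
    of their state. *)
Definition impossible : aexp := acst _ 1.

Definition icmd_guard (i : icmd) : seq aexp :=
  match i with
  | Skip => [::]
  | Digit _ => asub (acst _ 1) (avar VBu) :: ctl_is CDigits
  | EndDigits => avar VBu :: ctl_is CDigits
  | Witness _ => asub (acst _ 1) (avar VBu) :: ctl_is CWitness
  | Start => ctl_is CWitness
  | Step s a b => nseq (tm_halt s) impossible ++ ctl_is (CSim s) ++
      flatten [seq top_is (VR i) (a i) ++ top_is (VL i) (b i) | i <- enum 'I_k]
  | Accept s => nseq (~~ tm_halt s) impossible ++ ctl_is (CSim s) ++
      top_is (VR ord0) (Some (inl true))
  end.

Definition icmd_upd (i : icmd) (v : var) : aexp :=
  match i with
  | Skip => avar v
  | Digit a =>
      match v with
      | VDl => ascale 3%:R^-1 (avar VDl)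
      | VVa => aadd (avar VVa) (ascale ((dig a)%:R / 3%:R) (avar VDl))
      | VBu => asub (avar VBu) (acst _ 1)
      | VWt => append_wt (digit_bits a)
      | VQu => append_que (digit_bits a)
      | VP j => pow_upd 1 (isSome a) j
      | _ => avar v
      end
  | EndDigits =>
      match v with
      | VSt => acst _ (enum_rank CWitness)%:R
      | VBu => pol_eval q
      | VWt => append_wt [:: false]
      | VQu => append_que [:: false]
      | _ => avar v
      end
  | Witness b =>
      match v with
      | VBu => asub (avar VBu) (acst _ 1)
      | VWt => append_wt [:: b]
      | VQu => append_que [:: b]
      | _ => avar v
      end
  | Start =>
      match v with
      | VSt => acst _ (enum_rank (CSim (tm_init M)))%:R
      | VL i => acst _ 0
      | VR i => if i == ord0 then avar VQu else acst _ 0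
      | _ => avar v
      end
  | Step s a b =>
      match v with
      | VSt => acst _ (enum_rank (CSim (tm_delta s a).1))%:R
      | VL i => move_left_exp i (b i) ((tm_delta s a).2 i)
      | VR i => move_right_exp i (a i) (b i) ((tm_delta s a).2 i)
      | _ => avar v
      end
  | Accept s => if v is VSt then acst _ (enum_rank CAccept)%:R else avar v
  end.

Definition icmd_cmd (i : icmd) : cmd var := (icmd_guard i, icmd_upd i).

(** [enabled] and [effect] are the discrete semantics that guards and updates realize on encoded
    states. *)
Definition enabled (i : icmd) (r : rst) : bool :=
  match i with
  | Skip => true
  | Digit _ => (0 < bud r)%N && (ctl r == CDigits)
  | EndDigits => (bud r == 0)%N && (ctl r == CDigits)
  | Witness _ => (0 < bud r)%N && (ctl r == CWitness)
  | Start => ctl r == CWitness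
  | Step s a b => [&& ~~ tm_halt s, ctl r == CSim s &
      [forall i, (head None (tape_right (tps r i)) == a i) &&
                 (head None (tape_left (tps r i)) == b i)]]
  | Accept s => [&& tm_halt s, ctl r == CSim s &
      head None (tape_right (tps r ord0)) == Some (inl true)]
  end.

Definition effect (i : icmd) (r : rst) : rst :=
  match i with
  | Skip => r
  | Digit a => Rst (ctl r) (rcons (dgs r) a) (bud r).-1 (len r + isSome a)
                   (wrd r ++ digit_bits a) (tps r)
  | EndDigits => Rst CWitness (dgs r) q.[len r] (len r) (rcons (wrd r) false) (tps r)
  | Witness b => Rst (ctl r) (dgs r) (bud r).-1 (len r) (rcons (wrd r) b) (tps r)
  | Start => Rst (CSim (tm_init M)) (dgs r) (bud r) (len r) (wrd r)
                 (tm_start M (wrd r)).2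
  | Step s a b => let c := tm_step (s, tps r) in
      Rst (CSim c.1) (dgs r) (bud r) (len r) (wrd r) c.2
  | Accept s => Rst CAccept (dgs r) (bud r) (len r) (wrd r) (tps r)
  end.

Lemma impossible_ge x : (aval impossible x <= 0) = false.
Proof. by rewrite avalE rmorph1 ler10. Qed.

Lemma all_flatten (T : Type) (a : pred T) ss : all a (flatten ss) = all (all a) ss.
Proof. by elim: ss => //= s ss IH; rewrite all_cat IH. Qed.

Lemma icmd_guardP i c r :
  all (fun g => aval g (encode c r) <= 0) (icmd_guard i) = enabled i r.
Proof.
have bud1 (e := asub (acst _ 1) (avar VBu)) :
    (aval e (encode c r) <= 0) = (0 < bud r)%N.
  by rewrite aval_sub !avalE rmorph1 subr_le0 ler1n.
case: i => [|a||b||s a b|s]; rewrite /icmd_guard /enabled.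
- by [].
- by rewrite -(all_ctl_is c) -bud1.
- by rewrite -(all_ctl_is c) [LHS]/= avalE /= lern0.
- by rewrite -(all_ctl_is c) -bud1.
- exact: all_ctl_is.
- rewrite !all_cat all_ctl_is all_nseq impossible_ge orbF.
  rewrite eqb0; congr [&& _, _ & _].
  have H i : all (fun g => aval g (encode c r) <= 0)
      (top_is (VR i) (a i) ++ top_is (VL i) (b i)) =
      (head None (tape_right (tps r i)) == a i) &&
      (head None (tape_left (tps r i)) == b i).
    by rewrite all_cat (@all_top_is _ _ _ (tape_right (tps r i))) //
      (@all_top_is _ _ _ (tape_left (tps r i))).
  rewrite all_flatten all_map; apply/allP/forallP => [h i|h i _].
    by rewrite -H; apply: h; exact: mem_enum.
  by have := h i; rewrite -H.
- rewrite !all_cat all_ctl_is all_nseq impossible_ge orbF.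
  by rewrite eqb0 negbK (@all_top_is _ _ _ (tape_right (tps r ord0))).
Qed.

Lemma nval_rcons t a : nval (rcons t a) = (3 * nval t + dig a)%N.
Proof. by rewrite /nval foldl_rcons. Qed.

Lemma aval_append_que s c r :
  aval (append_que s) (encode c r) = stack R (cells (wrd r ++ s)).
Proof.
rewrite !avalE ratr_stack /cells map_cat stack_cat size_map /=.
by rewrite [X in _ + X]mulrC.
Qed.

Lemma aval_append_wt s c r :
  aval (append_wt s) (encode c r) = B%:R ^- size (wrd r ++ s).
Proof.
by rewrite !avalE fmorphV rmorphXn /= ratr_nat size_cat exprD invfM mulrC.
Qed.

Lemma aval_pred_bud c r : (0 < bud r)%N ->
  aval (asub (avar VBu) (acst _ 1)) (encode c r) = (bud r).-1%:R.
Proof. by move=> b0; rewrite aval_sub !avalE rmorph1 /= -subn1 natrB. Qed.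

Lemma aval_rest c r i :
  aval (rest_exp i (head None (tape_right (tps r i)))) (encode c r) =
  stack R (behead (tape_right (tps r i))).
Proof. by rewrite aval_sub !avalE !ratr_nat /= -stack_pop. Qed.

Lemma aval_push a e x : aval (push_exp a e) x = ((digit a)%:R + aval e x) / B%:R.
Proof. by rewrite !avalE fmorphV /= !ratr_nat mulrC. Qed.

Lemma icmd_updP i c r : enabled i r ->
  (fun v => aval (icmd_upd i v) (encode c r)) = encode c (effect i r).
Proof.
move=> en; apply/funext => v.
have id0 : aval (avar v) (encode c r) = encode c r v by rewrite avalE.
case: i en => [|a||b||s a b|s] en; rewrite /icmd_upd /effect.
- exact: id0.
- have /andP[b0 _] := en.
  case: v id0 => [| | | | | | |j|j|j] id0 //.
  + by rewrite !avalE /= size_rcons fmorphV /= ratr_nat exprS invfM.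
  + rewrite !avalE /= size_rcons fmorph_div /= !ratr_nat nval_rcons exprS natrD natrM.
    have : 3%:R ^+ size (dgs r) != 0 :> R by rewrite expf_neq0 ?pnatr_eq0.
    by move: (_ ^+ _) => u u0; field.
  + exact: aval_pred_bud.
  + exact: aval_append_wt.
  + exact: aval_append_que.
  + by rewrite (@aval_pow_upd _ _ _ _ (len r)) // mul1n.
- case: v id0 => [| | | | | | |j|j|j] id0 //.
  + by rewrite (@aval_pol_eval _ _ (len r)) // leq_maxr.
  + by rewrite avalE ratr_nat.
  + by rewrite aval_append_wt cats1.
  + by rewrite aval_append_que cats1.
- have /andP[b0 _] := en.
  case: v id0 => [| | | | | | |j|j|j] id0 //.
  + exact: aval_pred_bud.
  + by rewrite aval_append_wt cats1.
  + by rewrite aval_append_que cats1.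
- case: v id0 => [| | | | | | |j|j|j] id0 //=.
  + by rewrite avalE ratr_nat.
  + by rewrite avalE rmorph0.
  + by case: eqP; rewrite avalE // rmorph0.
- have /and3P[nh _ /forallP h] := en.
  have ea : [ffun i => tape_read (tps r i)] = a.
    by apply/ffunP => i; rewrite ffunE; have /andP[/eqP] := h i.
  rewrite /tm_step (negPf nh) /= ea.
  case: v id0 => [| | | | | | |j|j|j] id0 //=.
  + by rewrite avalE ratr_nat.
  + have /andP[_ /eqP <-] := h j; rewrite /move_left_exp.
    case: ((tm_delta s a).2 j) => w [] /=.
    * by rewrite aval_sub !avalE !ratr_nat /= -stack_pop; case: (tps r j).
    * by rewrite avalE /=; case: (tps r j).
    * by rewrite aval_push avalE /=; case: (tps r j).
  + have /andP[/eqP <- /eqP <-] := h j; rewrite /move_right_exp.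
    case: ((tm_delta s a).2 j) => w [] /=; rewrite ?aval_push aval_rest;
    by case: (tps r j) => l t /=.
- by case: v id0 => [| | | | | | |j|j|j] id0 //=; rewrite avalE ratr_nat.
Qed.

(** The affine simulation is exact: from an encoded state only encoded states are reached, so
    reasoning can move to discrete states. *)
Lemma run_icmd i c r y : run (cmd_stmt (icmd_cmd i)) (encode c r) y <->
  enabled i r /\ y = encode c (effect i r).
Proof.
rewrite run_cmd icmd_guardP; split=> -[en ->]; split=> //.
  exact: icmd_updP.
by rewrite -icmd_updP.
Qed.

End Simulation.

(** * The loop body *)

Section Statement.
Variables (R : realType) (M : TM) (p q : {poly nat}).
Local Notation k := (tm_tapes M).+1.
Local Notation X := (tm_aux M).
Local Notation d := (maxn (size p) (size q)).
Local Notation var := (var k d).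
Local Notation rst := (rst M).
Local Notation icmd := (icmd M).
Local Notation env := (var -> R).
Local Notation encode := (@encode R M p q).
Local Notation effect := (@effect M q).
Local Notation CDigits := (CDigits M).
Local Notation CWitness := (CWitness M).
Local Notation CAccept := (CAccept M).
Implicit Types (x y z : seq bool) (r : rst) (t : seq (option bool)).

(** Everything but the counter is reset, so [VC] alone carries information between iterations.
    [VP j] receives the power [j] of 0. *)
Definition init_upd (v : var) : aexp var :=
  match v with
  | VC => avar VC
  | VDl | VWt => acst _ 1
  | VSt => acst _ (enum_rank CDigits)%:R
  | VP j => acst _ (j == 0 :> nat)%:R
  | _ => acst _ 0
  end.

Definition init_rst : rst := Rst CDigits [::] 0 0 [::] (fun=> Tape [::] [::]).

Lemma run_init (e y : env) :
  run (assign init_upd) e y <-> y = encode (e VC) init_rst.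
Proof.
rewrite run_assign; suff -> : (fun v => aval (init_upd v) e) = encode (e VC) init_rst by [].
apply/funext => -[| | | | | | |j|j|j] //=; rewrite avalE ?rmorph0 ?rmorph1 ?ratr_nat //=.
- by rewrite expr0 invr1.
- by rewrite mul0r.
- by rewrite expr0 invr1.
- by rewrite expr0n.
Qed.

(** The machine reads [pair_bits (pair_bits x y) z], in which [x] is delimited twice; each of its
    bits thus becomes four. *)
Definition bit_upd (b : bool) (v : var) : aexp var :=
  match v with
  | VWt => append_wt M p q [:: true; true; true; b]
  | VQu => append_que M p q [:: true; true; true; b]
  | VP j => pow_upd M 1 1 j
  | _ => avar v
  end.

Definition bit_effect (b : bool) r : rst :=
  Rst (ctl r) (dgs r) (bud r) (len r).+1 (wrd r ++ [:: true; true; true; b]) (tps r).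

Lemma run_bit b c r (y : env) :
  run (assign (bit_upd b)) (encode c r) y <-> y = encode c (bit_effect b r).
Proof.
rewrite run_assign.
suff -> : (fun v => aval (bit_upd b v) (encode c r)) = encode c (bit_effect b r) by [].
apply/funext => -[| | | | | | |j|j|j] /=; try exact: aval_var.
- exact: aval_append_wt.
- exact: aval_append_que.
- by rewrite (aval_pow_upd _ _ _ (N := len r)) // mul1n addn1.
Qed.

(** The two letters are the end mark of [delimit x], itself doubled. The budget is computed from the
    old length [|x|], while the powers move on to the length [2|x| + 1] of [delimit x]. *)
Definition sep_upd (v : var) : aexp var :=
  match v with
  | VBu => pol_eval M p q p
  | VWt => append_wt M p q [:: true; false]
  | VQu => append_que M p q [:: true; false]
  | VP j => pow_upd M 2 1 j
  | _ => avar v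
  end.

Definition sep_effect r : rst :=
  Rst (ctl r) (dgs r) p.[len r] (2 * len r).+1 (wrd r ++ [:: true; false]) (tps r).

Lemma run_sep c r (y : env) :
  run (assign sep_upd) (encode c r) y <-> y = encode c (sep_effect r).
Proof.
rewrite run_assign.
suff -> : (fun v => aval (sep_upd v) (encode c r)) = encode c (sep_effect r) by [].
apply/funext => -[| | | | | | |j|j|j] /=; try exact: aval_var.
- by rewrite (aval_pol_eval (N := len r)) // leq_maxl.
- exact: aval_append_wt.
- exact: aval_append_que.
- by rewrite (aval_pow_upd _ _ _ (N := len r)) // addn1.
Qed.

(** Only here are the guessed digits compared with the counter, which is then raised by one unit of
    the last digit. *)
Definition finish_cmd : cmd var :=
  (ctl_is p q CAccept ++ aeq (avar VC) (avar VVa),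
   fun v => if v is VC then aadd (avar VC) (avar VDl) else avar v).

Lemma run_finish c r (y : env) : run (cmd_stmt finish_cmd) (encode c r) y <->
  [/\ ctl r = CAccept, c = (nval (dgs r))%:R / 3%:R ^+ size (dgs r) &
      y = encode (c + 3%:R ^- size (dgs r)) r].
Proof.
rewrite run_cmd.
have -> : all (fun e => aval e (encode c r) <= 0) finish_cmd.1 =
    (ctl r == CAccept) && (c == (nval (dgs r))%:R / 3%:R ^+ size (dgs r)).
  rewrite all_cat; congr (_ && _); first exact: all_ctl_is.
  by rewrite all_aeq !aval_var.
have -> : (fun v => aval (finish_cmd.2 v) (encode c r)) =
    encode (c + 3%:R ^- size (dgs r)) r.
  apply/funext => -[| | | | | | |j|j|j]; rewrite /finish_cmd /snd; try exact: aval_var.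
  by rewrite aval_add !aval_var.
split=> [[/andP[/eqP e /eqP h] ->] //|[e h ->]].
by rewrite e -h !eqxx.
Qed.

Definition block : stmt rat #|(var : finType)| :=
  choices (icmd_cmd p q (Skip M)) [seq icmd_cmd p q i | i <- enum {: icmd}].

Definition body (x : seq bool) (K : nat) : stmt rat #|(var : finType)| :=
  Seq (assign init_upd)
    (foldr (fun b => Seq (assign (bit_upd b)))
       (Seq (assign sep_upd) (iter K (Seq block) (cmd_stmt finish_cmd))) x).

Fixpoint reach (K : nat) r r' : Prop :=
  if K is j.+1 then exists2 i, enabled i r & reach j (effect i r) r' else r = r'.

Lemma run_block c r (y : env) : run block (encode c r) y <->
  exists2 i, enabled i r & y = encode c (effect i r).
Proof.
rewrite run_choices; split=> [[i _ /run_icmd[]]|[i en ->]]; first by exists i.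
exists i; last by apply/run_icmd.
by rewrite inE mem_enum orbT.
Qed.

Lemma run_blocks K c r (y : env) :
  run (iter K (Seq block) (cmd_stmt finish_cmd)) (encode c r) y <->
  exists2 r', reach K r r' & run (cmd_stmt finish_cmd) (encode c r') y.
Proof.
elim: K r => [|K IH] r /=; first by split=> [h|[_ <-]]; [exists r|].
rewrite run_seq; split=> [[_ /run_block[i en ->] /IH[r' h fy]]|[r' [i en h] fy]].
  by exists r' => //; exists i.
by exists (encode c (effect i r)); [apply/run_block; exists i|apply/IH; exists r'].
Qed.

Lemma run_bits (s : stmt rat #|(var : finType)|) x c r (y : env) :
  run (foldr (fun b => Seq (assign (bit_upd b))) s x) (encode c r) y <->
  run s (encode c (foldl (fun r b => bit_effect b r) r x)) y.
Proof.
elim: x r => [|b x IH] r //=; rewrite run_seq -IH.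
split=> [[_ /run_bit ->]//|h]; exists (encode c (bit_effect b r)) => //.
exact/run_bit.
Qed.

Definition loaded x : rst := sep_effect (foldl (fun r b => bit_effect b r) init_rst x).

Lemma run_body x K (e y : env) : run (body x K) e y <->
  exists r, [/\ reach K (loaded x) r, ctl r = CAccept,
    e VC = (nval (dgs r))%:R / 3%:R ^+ size (dgs r) &
    y = encode (e VC + 3%:R ^- size (dgs r)) r].
Proof.
rewrite run_seq; transitivity (run (iter K (Seq block) (cmd_stmt finish_cmd))
                                 (encode (e VC) (loaded x)) y).
  split=> [[_ /run_init ->]|h].
    by move/run_bits; rewrite run_seq => -[_ /run_sep ->].
  exists (encode (e VC) init_rst); first exact/run_init.
  apply/run_bits; rewrite run_seq; exists (encode (e VC) (loaded x)) => //.
  exact/run_sep.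
rewrite run_blocks; split=> [[r h /run_finish[a b f]]|[r [h a b f]]].
  by exists r.
by exists r => //; apply/run_finish.
Qed.

Definition doubled (w : seq bool) : seq bool := flatten [seq [:: true; b] | b <- w].

Lemma doubled_cat v w : doubled (v ++ w) = doubled v ++ doubled w.
Proof. by rewrite /doubled map_cat flatten_cat. Qed.

Lemma size_doubled w : size (doubled w) = (2 * size w)%N.
Proof. by elim: w => //= b w; rewrite /doubled /= => ->; lia. Qed.

Lemma delimitE w : delimit w = rcons (doubled w) false.
Proof. by rewrite /delimit cats1. Qed.

Lemma loadedE x : loaded x =
  Rst CDigits [::] p.[size x] (size (pair_bits x [::])) (doubled (pair_bits x [::]))
    (fun=> Tape [::] [::]).
Proof.
suff H r : foldl (fun r b => bit_effect b r) r x =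
    Rst (ctl r) (dgs r) (bud r) (len r + size x) (wrd r ++ doubled (doubled x)) (tps r).
  rewrite /loaded H /sep_effect /= add0n /pair_bits cats0 delimitE.
  by rewrite size_rcons size_doubled -cats1 [in RHS]doubled_cat.
elim: x r => [|b x IH] r /=; first by rewrite addn0 cats0; case: r.
by rewrite IH /= addSnnS -catA.
Qed.

End Statement.

(** * Runs of the loop body *)

Section Reachability.
Variables (M : TM) (p q rt : {poly nat}) (g : seq bool -> bool).
Hypothesis deciderM : forall w,
  let c := iter rt.[size w] (@tm_step M) (tm_start M w) in
  tm_halt c.1 /\ tm_output c = [:: g w].
Local Notation rst := (rst M).
Local Notation icmd := (icmd M).
Local Notation effect := (@effect M q).
Local Notation reach := (@reach M q).
Local Notation CDigits := (CDigits M).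
Local Notation CWitness := (CWitness M).
Local Notation CAccept := (CAccept M).
Local Notation loaded := (@loaded M p).
Implicit Types (x y z w : seq bool) (r : rst) (t : seq (option bool)).

(* The digit [None] is ignored, so that the digit strings of length [n]
   represent all words of length at most [n]. *)
Definition input x t := pair_bits x (pmap id t).

Definition good x t : Prop :=
  exists2 z, (size z <= q.[size (input x t)])%N & g (pair_bits (input x t) z).

(** Of two runs that have both halted the longer one repeats the shorter one's final configuration,
    so the time of halting is irrelevant. *)
Lemma halted_output w i (c := iter i (@tm_step M) (tm_start M w)) :
  tm_halt c.1 -> tm_output c = [:: g w].
Proof.
move=> h; have [h' <-] := deciderM w; congr tm_output.
have [le|le] := leqP i rt.[size w].
  by rewrite -(subnK le) iterD iter_halted.
by rewrite /c -(subnK (ltnW le)) iterD iter_halted.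
Qed.

(** One clause per phase: digits, witness, simulation, acceptance. In the guessing phases the
    guesses made and the budget add up to the bound; the digit phase must exhaust it, the witness
    phase may stop early. *)
Definition invariant x r : Prop :=
  match ctl r with
  | inl true => [/\ (size (dgs r) + bud r = p.[size x])%N,
      len r = size (input x (dgs r)) & wrd r = doubled (input x (dgs r))]
  | inl false => size (dgs r) = p.[size x] /\ exists2 z,
      wrd r = pair_bits (input x (dgs r)) z &
      (size z + bud r = q.[size (input x (dgs r))])%N
  | inr (Some s) => size (dgs r) = p.[size x] /\ exists z i,
      (size z <= q.[size (input x (dgs r))])%N /\
      (s, tps r) = iter i (@tm_step M) (tm_start M (pair_bits (input x (dgs r)) z))
  | inr None => size (dgs r) = p.[size x] /\ good x (dgs r)
  end.

Lemma invariant_loaded x : invariant x (loaded x).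
Proof. by rewrite loadedE. Qed.

Lemma input_rcons x t a :
  input x (rcons t a) = input x t ++ (if a is Some b then [:: b] else [::]).
Proof.
rewrite /input /pair_bits -catA -cats1 pmap_cat.
by case: a => //=.
Qed.

Lemma invariant_effect x r i : enabled i r -> invariant x r -> invariant x (effect i r).
Proof.
case: i => [|a||b||s a b|s] //=.
- move=> /andP[b0 /eqP e]; rewrite /invariant /= e => -[h1 h2 h3].
  rewrite size_rcons input_rcons size_cat doubled_cat h2 -h3; split.
  + by lia.
  + by case: a.
  + by case: a.
- move=> /andP[/eqP b0 /eqP e]; rewrite /invariant /= e => -[h1 h2 h3].
  split; first by lia.
  exists [::]; last by rewrite h2.
  by rewrite /pair_bits cats0 delimitE h3.
- move=> /andP[b0 /eqP e]; rewrite /invariant /= e => -[h1 [z h2 h3]].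
  split=> //; exists (rcons z b); last by rewrite size_rcons; lia.
  by rewrite h2 /pair_bits rcons_cat.
- move=> /eqP e; rewrite /invariant /= e => -[h1 [z h2 h3]].
  split=> //; exists z, 0%N; split; first by lia.
  by rewrite h2.
- move=> /and3P[nh /eqP e _]; rewrite /invariant /= e => -[h1 [z [n [h2 h3]]]].
  split=> //; exists z, n.+1; split=> //; rewrite iterS -h3.
  by case: (tm_step _).
- move=> /and3P[hs /eqP e /eqP hd]; rewrite /invariant /= e => -[h1 [z [n [h2 h3]]]].
  split=> //; exists z => //.
  have := @halted_output (pair_bits (input x (dgs r)) z) n; rewrite -h3 => /(_ hs).
  by rewrite /tm_output /=; case: (tape_right _) hd => //= _ l ->; case.
Qed.

Lemma invariant_reach x K r r' : reach K r r' -> invariant x r -> invariant x r'.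
Proof.
elim: K r => [|K IH] r /=; first by move=> ->.
by move=> [i en h] ir; apply: IH h _; exact: invariant_effect.
Qed.

(** Soundness of the simulation, read off the last clause of the invariant. *)
Lemma reach_accept_good x K r : reach K (loaded x) r -> ctl r = CAccept ->
  size (dgs r) = p.[size x] /\ good x (dgs r).
Proof.
move=> h e; have := invariant_reach h (invariant_loaded x).
by rewrite /invariant e.
Qed.

Lemma reach_trans K1 K2 r1 r2 r3 : reach K1 r1 r2 -> reach K2 r2 r3 ->
  reach (K1 + K2) r1 r3.
Proof.
elim: K1 r1 => [|K1 IH] r1 /=; first by move=> ->.
by move=> [i en h] h2; exists i => //; exact: IH.
Qed.

Lemma reach_le K1 K2 r1 r2 : (K1 <= K2)%N -> reach K1 r1 r2 -> reach K2 r1 r2.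
Proof.
move=> /subnK <-; elim: (K2 - K1)%N => //= n IH h; exists (Skip M) => //.
exact: IH.
Qed.

Lemma reach_digits t r : ctl r = CDigits -> (size t <= bud r)%N ->
  exists r', [/\ reach (size t) r r', ctl r' = CDigits, dgs r' = dgs r ++ t &
                 bud r' = (bud r - size t)%N].
Proof.
elim: t r => [|a t IH] r e le.
  by exists r; rewrite cats0 subn0.
have [//||r' [h e' d' b']] := IH (effect (Digit M a) r).
  by move: le => /=; lia.
exists r'; split=> //.
- by exists (Digit M a) => //=; rewrite e eqxx andbT; move: le => /=; lia.
- by rewrite d' /= -cats1 -catA.
- by rewrite b' /=; lia.
Qed.

Lemma reach_witness z r : ctl r = CWitness -> (size z <= bud r)%N ->
  exists r', [/\ reach (size z) r r', ctl r' = CWitness, dgs r' = dgs r &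
                 wrd r' = wrd r ++ z].
Proof.
elim: z r => [|b z IH] r e le.
  by exists r; rewrite cats0.
have [//||r' [h e' d' w']] := IH (effect (Witness M b) r).
  by move: le => /=; lia.
exists r'; split=> //.
- by exists (Witness M b) => //=; rewrite e eqxx andbT; move: le => /=; lia.
- by rewrite w' /= -cats1 -catA.
Qed.

Lemma reach_sim n r s (c := iter n (@tm_step M) (s, tps r)) : ctl r = CSim s ->
  exists r', [/\ reach n r r', ctl r' = CSim c.1, dgs r' = dgs r & tps r' = c.2].
Proof.
(* No [Step] is enabled in a halting state, so fewer than [n] commands may be available; the rest is
   filled with [Skip]. *)
move=> e; have : exists2 m, (m <= n)%N & exists r',
    [/\ reach m r r', ctl r' = CSim c.1, dgs r' = dgs r & tps r' = c.2].
  rewrite /c; elim: n r s e {c} => [|n IH] r s e; first by exists 0%N => //; exists r.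
  have [hs|nh] := boolP (tm_halt s).
    by exists 0%N => //; exists r; rewrite iter_halted.
  pose i := Step s [ffun i => head None (tape_right (tps r i))]
                   [ffun i => head None (tape_left (tps r i))].
  have en : enabled i r.
    rewrite /= nh e eqxx /=; apply/forallP => j; by rewrite !ffunE !eqxx.
  have [|m le [r' [h e' d' t']]] := IH (effect i r) (tm_step (s, tps r)).1; first by [].
  exists m.+1 => //; exists r'; split=> //; first by exists i.
  - by rewrite iterSr e' /= -surjective_pairing.
  - by rewrite iterSr t' /= -surjective_pairing.
by move=> [m le [r' [h ? ? ?]]]; exists r'; split=> //; exact: reach_le le h.
Qed.

(** Completeness of the simulation: guess the digits, guess the witness, simulate, accept. The
    constant 3 counts [EndDigits], [Start] and [Accept]. *)
Lemma good_reach_accept x t K : size t = p.[size x] -> good x t ->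
  (forall z, (size z <= q.[size (input x t)])%N ->
    p.[size x] + (size z + (rt.[size (pair_bits (input x t) z)] + 3)) <= K)%N ->
  exists r, [/\ reach K (loaded x) r, ctl r = CAccept & dgs r = t].
Proof.
move=> st [z sz gz] /(_ z sz) leK.
have inv0 := invariant_loaded x.
have [||r1 [h1 c1 d1 b1]] := @reach_digits t (loaded x).
- by rewrite loadedE.
- by rewrite loadedE /= st.
rewrite loadedE /= in d1; rewrite loadedE /= st subnn in b1.
have := invariant_reach h1 inv0; rewrite /invariant c1 /= d1 => -[_ l1 w1].
pose r2 := effect (EndDigits M) r1.
have [||r3 [h3 c3 d3 w3]] := @reach_witness z r2; first by [].
  by rewrite /= l1.
pose r4 := effect (Start M) r3.
have w3' : wrd r3 = pair_bits (input x t) z by rewrite w3 /= w1 /pair_bits delimitE.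
pose n := rt.[size (wrd r3)].
have [//|r5 [h5 c5 d5 t5]] := @reach_sim n r4 (tm_init M).
set c := iter _ _ _ in c5 t5.
have [hh ho] := deciderM (wrd r3).
have hd : head None (tape_right (tps r5 ord0)) = Some (inl true).
  move: ho; rewrite t5 /tm_output -/n [X in g X]w3' gz.
  by case: (tape_right _) => //= -[[b|]|] //= l [-> _].
have reach1 i r : enabled i r -> reach 1 r (effect i r) by exists i.
exists (effect (Accept c.1) r5); split=> //; last by rewrite /= d5 /= d3 /= d1.
suff tot : reach (size t + (1 + (size z + (1 + (n + 1)))))%N (loaded x)
    (effect (Accept c.1) r5).
  by apply: reach_le tot; move: leK; rewrite -st -w3' -/n; lia.
apply: (reach_trans h1); apply: reach_trans.
  by apply: (@reach1 (EndDigits M)); rewrite /= c1 b1 !eqxx.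
apply: (reach_trans h3); apply: reach_trans.
  by apply: (@reach1 (Start M)); rewrite /= c3.
apply: (reach_trans h5); apply: reach1.
by rewrite /= hh c5 hd !eqxx.
Qed.

End Reachability.

(** * The abstract semantics of the counter program *)

Section Galois.
Local Open Scope classical_set_scope.
Variable R : realType.

(** The Galois connection: each row of [gamma] is an upper bound, so the infimum of all bounds valid
    on [X] is still valid on [X]. *)
Lemma alpha_gamma m n (T : 'M[R]_(m, n)) (X : set 'cV[R]_n) (e : 'cV[\bar R]_m) :
  vle (alpha T X) e <-> X `<=` gamma T e.
Proof.
split=> [le x Xx i|le]; last exact: meet_lb.
apply: le_trans (le i); rewrite [leRHS]mxE; apply: le_ereal_inf_tmp => _ [e' Xe' <-].
exact: Xe'.
Qed.

(** By the Galois connection, solutions are the inductive invariants expressible in the template,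
    and [alpha] need not be computed. *)
Lemma abs_solutionP n m (N : finType) (G : aprog R n N) (T : 'M[R]_(m, n))
    (V : N -> 'cV[\bar R]_m) :
  abs_solution G T V <-> setT `<=` gamma T (V (start G)) /\
    forall u s v, List.In (u, s, v) (edges G) ->
      collect s (gamma T (V u)) `<=` gamma T (V v).
Proof.
rewrite /abs_solution alpha_gamma.
by split=> -[h0 h]; split=> // u s v /h; rewrite /abs_stmt alpha_gamma.
Qed.

End Galois.

(** * Ternary digit strings as numbers *)

Lemma nval_lt t : (nval t < 3 ^ size t)%N.
Proof.
elim/last_ind: t => [|t a IH] //; rewrite nval_rcons size_rcons expnS.
by have : (dig a < 3)%N; [case: a => // -[]|lia].
Qed.

Lemma nval_inj t1 t2 : size t1 = size t2 -> nval t1 = nval t2 -> t1 = t2.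
Proof.
elim/last_ind: t1 t2 => [|t1 a IH] t2; first by case: t2.
case/lastP: t2 => [|t2 b]; rewrite !size_rcons // => -[sz].
rewrite !nval_rcons => e.
have lt c : (dig c < 3)%N by case: c => // -[].
have la := lt a; have lb := lt b; rewrite (IH t2) //; last by lia.
have : dig a = dig b by lia.
by case: a b {e la lb} => [[]|] [[]|].
Qed.

Lemma nval_surj n v : (v < 3 ^ n)%N -> exists2 t, size t = n & nval t = v.
Proof.
elim: n v => [|n IH] v; first by case: v => // _; exists [::].
rewrite expnS => lt; have [|t sz e] := IH (v %/ 3)%N; first by lia.
have [a ea] : exists a, dig a = (v %% 3)%N.
  have : (v %% 3 < 3)%N by rewrite ltn_mod.
  case: (v %% 3)%N => [|[|[|//]]] _; by [exists (Some false)|exists (Some true)|exists None].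
exists (rcons t a); first by rewrite size_rcons sz.
by rewrite nval_rcons e ea; lia.
Qed.

(** * The counter program and its least solution *)

Section Instance.
Variables (R : realType) (M : TM) (p q rt : {poly nat}) (g : seq bool -> bool).
Hypothesis deciderM : forall w,
  let c := iter rt.[size w] (@tm_step M) (tm_start M w) in
  tm_halt c.1 /\ tm_output c = [:: g w].
Local Notation var := (var (tm_tapes M).+1 (maxn (size p) (size q)) : finType).
Local Notation env := (var -> R).
Local Notation good := (good q g).
Local Notation body := (body M p q).

Definition pt0 : 'I_3 := @Ordinal 3 0 isT.
Definition pt1 : 'I_3 := @Ordinal 3 1 isT.
Definition pt2 : 'I_3 := @Ordinal 3 2 isT.

Definition reset : stmt rat #|var| :=
  assign (fun v : var => if v is VC then acst _ 0 else avar v).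
Definition exit_guard : stmt rat #|var| :=
  guard [:: asub (acst _ 1) (avar VC) : aexp var].

Definition counter_template : 'M[rat]_(1, #|var|) :=
  \matrix_(i, j) (enum_val j == VC)%:R.

Definition counter_instance x K : instance :=
  @Instance #|var| 1 3
    (AProg [:: (pt0, reset, pt1); (pt1, body x K, pt1); (pt1, exit_guard, pt2)] pt0)
    counter_template pt2.

Lemma counter_edges x K u (s : stmt R #|var|) v :
  List.In (u, s, v) (edges (map_aprog ratr (inst_prog (counter_instance x K)))) <->
  [\/ [/\ u = pt0, s = map_stmt ratr reset & v = pt1],
      [/\ u = pt1, s = map_stmt ratr (body x K) & v = pt1] |
      [/\ u = pt1, s = map_stmt ratr exit_guard & v = pt2]].
Proof.
rewrite /map_aprog [edges _]/(map _ _) /map /List.In /=.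
split; first by do 2! [case=> [[<- <- <-]|]; [by constructor|]]; case=> [[<- <- <-]|//]; constructor.
by case=> -[-> -> ->]; tauto.
Qed.

Lemma gamma_counter (d : 'cV[\bar R]_1) (e : env) :
  gamma (map_mx ratr counter_template) d (vec e) <-> ((e VC)%:E <= d ord0 ord0)%E.
Proof.
have h i : (map_mx ratr counter_template *m vec e) i ord0 = e VC.
  rewrite mxE (bigD1 (enum_rank (VC : var))) //= !mxE enum_rankK eqxx rmorph1 mul1r.
  rewrite big1 ?addr0 // => j jne; rewrite !mxE.
  rewrite (_ : enum_val j == VC = false) ?rmorph0 ?mul0r //.
  by apply: contraNF jne => /eqP <-; rewrite enum_valK.
rewrite /gamma /=; split=> [/(_ ord0)|le i]; rewrite h //.
by rewrite (ord1 i).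
Qed.

(** The number in [0, 1) with the ternary digits [t] after the point. *)
Definition frac (t : seq (option bool)) : R := (nval t)%:R / 3%:R ^+ size t.

Lemma run_body_good x K (e y : env) : run (body x K) e y ->
  exists t, [/\ size t = p.[size x], good x t, e VC = frac t &
    y VC = frac t + 3%:R ^- size t].
Proof.
move=> /run_body[r [h c f ->]]; have [sz gd] := reach_accept_good deciderM h c.
by exists (dgs r); split=> //=; rewrite f.
Qed.

Definition enough_steps x K := forall t z, size t = p.[size x] ->
  (size z <= q.[size (input x t)])%N ->
  (p.[size x] + (size z + (rt.[size (pair_bits (input x t) z)] + 3)) <= K)%N.

Lemma good_run_body x K t (e : env) : enough_steps x K ->
  size t = p.[size x] -> good x t -> e VC = frac t ->
  exists2 y : env, run (body x K) e y & y VC = frac t + 3%:R ^- size t.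
Proof.
move=> es sz gd f; have [|r [h c d]] := good_reach_accept deciderM (K := K) sz gd.
  by move=> z; exact: es.
exists (encode (e VC + 3%:R ^- size (dgs r)) r); last by rewrite /= f d.
by apply/run_body; exists r; rewrite d.
Qed.

Lemma target_aboveP x K : enough_steps x K ->
  target_above_bottom R (counter_instance x K) <->
  forall t, size t = p.[size x] -> good x t.
Proof.
move=> es; set n := p.[size x].
have pos : 0 < 3%:R ^+ n :> R by rewrite exprn_gt0 ?ltr0n.
split=> [[V [[solV minV] gtV]] t sz|gd].
  apply: contrapT => ngd; case: gtV => _; apply; apply/colP => i.
  rewrite mxE; apply/esym/eqP; rewrite -leeNy_eq.
  (* If [t] is not good, then [frac t] is an inductive bound of the counter, and it leaves the
     target empty. *)
  pose W (u : 'I_3) : 'cV[\bar R]_1 := const_mx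
    (if u == pt0 then +oo%E else if u == pt1 then (frac t)%:E else -oo%E).
  have := minV W _ pt2 i; rewrite mxE; apply.
  apply/abs_solutionP; split=> [y _ j|u s v].
    by rewrite [leRHS]mxE /= leey.
  move=> /counter_edges[] [-> -> ->] y /collect_run[e ge er];
    rewrite -[y]unvecK gamma_counter mxE /=.
  - have -> : unvec y VC = 0 by move/run_assign: er => ->; rewrite aval_cst rmorph0.
    by rewrite lee_fin divr_ge0 ?exprn_ge0 ?ler0n.
  - move: ge; rewrite gamma_counter mxE /= lee_fin.
    have [t' [sz' gd' -> ->]] := run_body_good er.
    rewrite /frac sz sz' -/n => le; rewrite lee_fin -[X in _ + X <= _]mul1r -mulrDl.
    (* The body starts only at a numerator [nval t'] with [t'] good. It is at most [nval t] but
       different from it, so adding one unit does not pass [frac t]. *)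
    move: le; rewrite !ler_pM2r ?invr_gt0 // natr1 !ler_nat leq_eqVlt.
    case/orP => // /eqP /nval_inj e'; case: ngd.
    by rewrite -e' // sz.
  - move/run_guard: er => [_ /=]; rewrite andbT aval_sub aval_cst aval_var rmorph1.
    move: ge; rewrite gamma_counter mxE /= lee_fin subr_le0 => h1 h2.
    (* As [frac t] is below 1, no state passes the exit guard. *)
    have := le_trans h2 h1; rewrite /frac ler_pdivlMr ?exprn_gt0 ?ltr0n // mul1r.
    by rewrite -natrX ler_nat leqNgt nval_lt.
have [V [solV minV]] := abs_semantics_ex (map_aprog ratr (inst_prog (counter_instance x K)))
  (map_mx (ratr : rat -> R) (inst_templ (counter_instance x K))).
exists V; split=> //; have /abs_solutionP[/= h0 hE] := solV.
have edge (u v : 'I_3) (s : stmt rat #|var|) (e y : env) :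
    List.In (u, map_stmt ratr s, v) (edges (map_aprog (ratr : rat -> R)
      (inst_prog (counter_instance x K)))) ->
    ((e VC)%:E <= V u ord0 ord0)%E -> run s e y -> ((y VC)%:E <= V v ord0 ord0)%E.
  move=> /hE sub /gamma_counter ge er; apply/gamma_counter/sub/collect_run.
  by exists e; rewrite ?vecK.
(* The template bounds the counter only from above. Hence a bound of at least [j / 3 ^ n] admits the
   state whose counter is exactly this value, and from there the body reaches the next level. *)
have lvl j : (j <= 3 ^ n)%N -> ((j%:R / 3%:R ^+ n)%:E <= V pt1 ord0 ord0)%E.
  elim: j => [_|j IH lt].
    pose y : env := fun v => aval (if v is VC then acst _ 0 else avar v) (fun=> 0).
    have y0 : y VC = 0 by rewrite /y aval_cst rmorph0.
    rewrite mul0r -y0; apply: (edge pt0 pt1 reset (fun=> 0)).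
    + by left.
    + exact/(gamma_counter _ (fun=> 0))/h0.
    + exact/run_assign.
  have [t sz nt] := nval_surj lt.
  have [y er] := @good_run_body x K t (fun=> frac t) es sz (gd t sz) erefl.
  rewrite /frac sz nt -[X in _ + X]mul1r -mulrDl natr1 => <-.
  apply: (edge pt1 pt1 (body x K) (fun=> frac t)) er; first by right; left.
  by rewrite /frac sz nt; apply: IH; exact: ltnW.
split=> [i|/colP/(_ ord0)]; rewrite mxE ?leNye // => V2.
(* The level [3 ^ n] is the counter value 1, which passes the exit guard. *)
suff : ((1 : R)%:E <= V pt2 ord0 ord0)%E by rewrite -V2 leeNy_eq.
apply: (edge pt1 pt2 exit_guard (fun=> 1) (fun=> 1)).
- by right; right; left.
- by have := lvl _ (leqnn _); rewrite natrX divff // gt_eqF.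
- by apply/run_guard; split=> //=; rewrite aval_sub aval_cst aval_var rmorph1 subrr lexx.
Qed.

End Instance.

(** * The reduction *)

Section Encoding.
Variables (M : TM) (p q : {poly nat}).
Local Notation var := (var (tm_tapes M).+1 (maxn (size p) (size q)) : finType).
Local Notation then_bits s := ([:: true; false] ++ enc_stmt s).

(** The two numbers 3 count the points and the edges. The last [enc_unary pt1] is the source of the
    loop edge, whose code extends into [enc_suffix]. *)
Definition enc_prefix : seq bool :=
  enc_unary #|var| ++ enc_unary 1 ++ enc_unary 3 ++ enc_unary 3 ++
  enc_edge (pt0, reset M p q, pt1) ++ enc_unary pt1 ++
  then_bits (assign (@init_upd M p q)).

Definition enc_bit (b : bool) : seq bool := then_bits (assign (@bit_upd M p q b)).

Definition enc_suffix : seq bool :=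
  enc_stmt (cmd_stmt (finish_cmd M p q)) ++ enc_unary pt1 ++
  enc_edge (pt1, exit_guard M p q, pt2) ++ enc_unary pt0 ++
  enc_mx (counter_template M p q) ++ enc_unary pt2.

(** Sequencing in the body is nested to the right, so each component contributes the tag of [Seq]
    and its own code. The whole code is then a concatenation of the form that [polytime_emit]
    prints. *)
Lemma enc_counter_instance x K : enc_instance (counter_instance M p q x K) =
  enc_prefix ++ flatten [seq enc_bit b | b <- x] ++ then_bits (assign (@sep_upd M p q)) ++
  flatten (nseq K (then_bits (block M p q))) ++ enc_suffix.
Proof.
have blocks s : enc_stmt (iter K (Seq (block M p q)) s) =
    flatten (nseq K (then_bits (block M p q))) ++ enc_stmt s.
  by elim: K => //= K ->; rewrite -catA.
have load s : enc_stmt (foldr (fun b => Seq (assign (@bit_upd M p q b))) s x) =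
    flatten [seq enc_bit b | b <- x] ++ enc_stmt s.
  elim: x => [//|b x IH]; by rewrite [in RHS]/= -catA -IH.
have body_enc : enc_stmt (body M p q x K) = then_bits (assign (@init_upd M p q)) ++
    flatten [seq enc_bit b | b <- x] ++ then_bits (assign (@sep_upd M p q)) ++
    flatten (nseq K (then_bits (block M p q))) ++
    enc_stmt (cmd_stmt (finish_cmd M p q)).
  rewrite -blocks -(catA _ (enc_stmt _) (enc_stmt _)).
  rewrite -[_ ++ _ ++ enc_stmt (iter _ _ _)]/(enc_stmt (Seq (assign (@sep_upd M p q)) _)).
  by rewrite -load -catA.
rewrite /enc_instance /enc_aprog /counter_instance.
cbn [inst_vars inst_rows inst_points inst_prog inst_templ inst_target edges start map size].
rewrite /flatten /foldr cats0 {2}/enc_edge.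
cbn [fst snd]; rewrite body_enc /enc_prefix /enc_suffix.
by rewrite -!catA.
Qed.

End Encoding.

(** * Bounding the number of repetitions *)

Lemma horner_mono (f : {poly nat}) m n : (m <= n)%N -> (f.[m] <= f.[n])%N.
Proof.
move=> le; elim/poly_ind: f => [|f c IH]; first by rewrite !horner0.
by rewrite !hornerD !hornerM !hornerX !hornerC leq_add2r leq_mul.
Qed.

Lemma poly_bounded_horner (f : {poly nat}) T :
  poly_bounded T -> poly_bounded (fun n => f.[T n])%N.
Proof.
move=> hT; elim/poly_ind: f => [|f c [h hh]].
  by exists 0 => n; rewrite !horner0.
have [h' hh'] : poly_bounded (fun n => f.[T n] * T n + c)%N.
  apply: poly_bounded_add; last exact: poly_bounded_const.
  by apply: poly_bounded_mul => //; exists h.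
by exists h' => n; rewrite hornerD hornerM hornerX hornerC; exact: hh'.
Qed.

(** A repetition count of this form can be printed by [D] nested loops around [c] copies.
    Lower-order terms are absorbed since [n.+1] is positive. *)
Lemma poly_bounded_power T : poly_bounded T ->
  exists c D, forall n, (T n <= n.+1 ^ D * c)%N.
Proof.
move=> [f hf]; suff [c [D h]] : exists c D, forall n, (f.[n] <= n.+1 ^ D * c)%N.
  by exists c, D => n; exact: leq_trans (hf n) (h n).
elim/poly_ind: f {hf} => [|f a [c [D h]]]; first by exists 0%N, 0%N => n; rewrite horner0.
exists (c + a)%N, D.+1 => n; rewrite hornerD hornerM hornerX hornerC.
rewrite mulnDr; apply: leq_add; last by rewrite leq_pmull // expn_gt0.
rewrite expnS -mulnA mulnC; apply: leq_mul => //.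
Qed.

Lemma size_delimit w : size (delimit w) = (2 * size w).+1.
Proof. by rewrite delimitE size_rcons size_doubled. Qed.

Lemma flatten_nseqM (T : Type) a b (s : seq T) :
  flatten (nseq (a * b) s) = flatten (nseq a (flatten (nseq b s))).
Proof. by elim: a => //= a IH; rewrite mulSn flatten_nseqD IH. Qed.

Lemma enough_steps_power (p q rt : {poly nat}) : exists c D,
  forall x, enough_steps p q rt x ((size x).+1 ^ D * c).
Proof.
(* [S] bounds the length of [input x t], where [delimit x] has length [2|x| + 1]; [W] bounds the
   length after a witness is attached. *)
pose S n := (2 * n + 1 + p.[n])%N.
pose W n := (2 * S n + 1 + q.[S n])%N.
have pS : poly_bounded S.
  apply: poly_bounded_add; last by exists p.
  apply: poly_bounded_add; last exact: poly_bounded_const.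
  by apply: poly_bounded_mul poly_bounded_id; exact: poly_bounded_const.
have pW : poly_bounded W.
  apply: poly_bounded_add; last exact: poly_bounded_horner.
  apply: poly_bounded_add; last exact: poly_bounded_const.
  by apply: poly_bounded_mul pS; exact: poly_bounded_const.
have [|c [D h]] := @poly_bounded_power (fun n => p.[n] + (q.[S n] + (rt.[W n] + 3)))%N.
  apply: poly_bounded_add; first by exists p.
  apply: poly_bounded_add; first exact: poly_bounded_horner.
  apply: poly_bounded_add; [exact: poly_bounded_horner|exact: poly_bounded_const].
exists c, D => x t z st sz; apply: leq_trans (h (size x)).
have le1 : (size (input x t) <= S (size x))%N.
  rewrite /input /pair_bits size_cat size_delimit /S.
  have : (size (pmap id t) <= size t)%N by rewrite size_pmap count_size.
  by rewrite st; lia.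
have le2 := leq_trans sz (horner_mono q le1).
have le3 : (size (pair_bits (input x t) z) <= W (size x))%N.
  by rewrite /pair_bits size_cat size_delimit /W; lia.
have le4 := horner_mono rt le3.
by rewrite leq_add2l leq_add // leq_add2r.
Qed.

Theorem theorem8 (R : realType) : hard (PiP 2) (abs_reach_problem R).
Proof.
move=> L [L1 [p [[L2 [q [[g [M [rt deciderM]] L2g] L1P]]] LP]]].
have [c [D es]] := enough_steps_power p q rt.
exists (fun x => enc_instance (counter_instance M p q x ((size x).+1 ^ D * c))).
  have := polytime_emit D (enc_prefix M p q) (enc_suffix M p q)
    ([:: true; false] ++ enc_stmt (assign (@sep_upd M p q)))
    (flatten (nseq c ([:: true; false] ++ enc_stmt (block M p q)))) (enc_bit M p q).
  by congr polytime; apply/funext => x; rewrite enc_counter_instance flatten_nseqM.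
move=> x; have tP := target_aboveP R deciderM (es x).
(* Words of length at most [p(|x|)] are traded for digit strings of length exactly [p(|x|)]. *)
have -> : L x <-> forall t, size t = p.[size x] -> good q g x t.
  rewrite LP; split=> [h t st|h y sy].
    have /h /L1P[z [sz /L2g gz]] : (size (pmap id t) <= p.[size x])%N.
      by rewrite -st size_pmap count_size.
    by exists z.
  (* A shorter word is padded with the ignored digit. *)
  pose t := [seq Some b | b <- y] ++ nseq (p.[size x] - size y) None.
  have [|z sz gz] := h t; first by rewrite size_cat size_map size_nseq subnKC.
  have ty : pmap id t = y.
    rewrite pmap_cat (_ : pmap id (nseq _ _) = [::]) ?cats0; last by elim: (_ - _)%N.
    by elim: y {sy t sz gz} => //= b y ->.
  by apply/L1P; exists z; move: sz gz; rewrite /input ty => sz gz; split=> //; exact/L2g.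
(* The problem asks for some instance with the given code; injectivity of the encoding makes it the
   constructed one. *)
split=> [h|[I [/enc_instance_inj <-]]]; last by move/tP.
by exists (counter_instance M p q x ((size x).+1 ^ D * c)); split=> //; exact/tP.
Qed.
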